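(* Let $m\ge 1$ be a natural number and $n=2m+3$. Let $F=\mathbb{Z}^{2m}$ with basis $\{g_1,\ldots,g_{2m}\}$, let $G=\mathbb{Z}^3$, and let $\mathcal{A}=\operatorname{Sym}_{\mathbb{Z}}(\bigwedge^2F\oplus F\otimes G)\cong\mathbb{Z}[c_{ij},u_{ki}]$, where $1\le i<j\le 2m$ for the $c_{ij}$ and $1\le k\le3$, $1\le i\le 2m$ for the $u_{ki}$. Set $$C=\sum_{1\le i<j\le 2m}c_{ij}\,g_i\wedge g_j\quad\text{and}\quad u_k=\sum_{i=1}^{2m}u_{ki}g_i\ \text{ for }1\le k\le 3.$$ The ideal $$\mathcal{I}_n=(C^m,\ C^{m-1}\wedge u_1\wedge u_2,\ C^{m-1}\wedge u_1\wedge u_3,\ C^{m-1}\wedge u_2\wedge u_3)$$ of $\mathcal{A}$ is a grade $3$ almost complete intersection ideal of type $2m=n-3$.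
   Context: Let $A=(c_{ij})$ be the generic $2m\times 2m$ skew symmetric matrix ($c_{ji}=-c_{ij}$, $c_{ii}=0$). $C^j$ denotes the $j$-th (divided) exterior power of $C$ in $\bigwedge^{2j}F\otimes\mathcal{A}$, that is, $$C^j=\sum_{1\le i_1<\cdots<i_{2j}\le 2m}\operatorname{Pf}_{i_1\ldots i_{2j}}(A)\; g_{i_1}\wedge\cdots\wedge g_{i_{2j}},\qquad C^0=1,$$ where $\operatorname{Pf}_{i_1\ldots i_{2j}}(A)$ is the Pfaffian of the submatrix of $A$ on the rows and columns $i_1,\dots,i_{2j}$. The listed generators are elements of $\bigwedge^{2m}F\otimes\mathcal{A}\cong\mathcal{A}$, identified with elements of $\mathcal{A}$ via the basis element $g_1\wedge\cdots\wedge g_{2m}$. The ring $\mathcal{A}$ is bigraded by $|c_{ij}|=(1,0)$, $|u_{ki}|=(0,1)$. A grade $3$ almost complete intersection ideal is a perfect ideal of grade $3$ minimally generated by four elements; its type is the rank of the third free module in the minimal (graded) free resolution of the quotient ring by the ideal. *)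

(* Defs.v *)
From HB Require Import structures.
From mathcomp Require Import all_boot all_order all_algebra all_fingroup.
From mathcomp Require Import generic_quotient ring_quotient boolp mpoly.

Set Implicit Arguments.
Unset Strict Implicit.
Unset Printing Implicit Defensive.

Import GRing.Theory.
Local Open Scope ring_scope.

(* Ideals of R are the submodules of the regular module R^o. Membership in a
   generated submodule is undecidable in general; asbool (`[< _ >]) makes it a
   boolean predicate, as the quotient construction requires. *)

Section Span.
Variables (R : comNzRingType) (V : lmodType R).

Definition span_of (s : seq V) : {pred V} :=
  fun v => `[< exists a : 'I_(size s) -> R, v = \sum_i a i *: s`_i >].

Lemma span_of_submod_closed (s : seq V) : submod_closed (span_of s).
Proof.
split=> [|a u v /asboolP[b ->] /asboolP[c ->]]; apply/asboolP.
  by exists (fun=> 0); rewrite big1 // => i _; rewrite scale0r.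
exists (fun i => a * b i + c i); rewrite scaler_sumr -big_split /=.
by apply: eq_bigr => i _; rewrite scalerDl scalerA.
Qed.

HB.instance Definition _ (s : seq V) :=
  GRing.isSubmodClosed.Build R V (span_of s) (span_of_submod_closed s).

End Span.

Section QuotientModule.
Variables (R : comNzRingType) (V : lmodType R) (U : submodClosed V).

Definition submod_pred : {pred V} := fun v => v \in U.

Fact submod_pred_zmod_closed : zmod_closed submod_pred.
Proof. exact: GRing.submod_closedB (submodClosedP U). Qed.

HB.instance Definition _ :=
  GRing.isZmodClosed.Build V submod_pred submod_pred_zmod_closed.

Definition quot_module := Quotient.quot submod_pred.
HB.instance Definition _ := GRing.Zmodule.on quot_module.

Definition quot_proj (v : V) : quot_module := (\pi_(Quotient.quot submod_pred) v)%qT.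

Definition quot_scale (a : R) (x : quot_module) : quot_module :=
  quot_proj (a *: repr (x : Quotient.quot submod_pred)).

Lemma quot_projP (v w : V) : quot_proj v = quot_proj w <-> v - w \in U.
Proof.
rewrite -[v - w \in U]/(v - w \in submod_pred) Quotient.idealrBE.
by split=> /eqP.
Qed.

Lemma quot_projK (x : quot_module) : quot_proj (repr (x : Quotient.quot submod_pred)) = x.
Proof. exact: (@reprK _ (Quotient.quot submod_pred)). Qed.

Lemma quot_projD : {morph quot_proj : v w / v + w}.
Proof. by move=> v w; rewrite /quot_proj !piE. Qed.

Lemma quot_scale_proj a v : quot_scale a (quot_proj v) = quot_proj (a *: v).
Proof.
by apply/quot_projP; rewrite -scalerBr rpredZ //; apply/quot_projP/quot_projK.
Qed.

Fact quot_scaleA a b x : quot_scale a (quot_scale b x) = quot_scale (a * b) x.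
Proof. by rewrite -[x]quot_projK !quot_scale_proj scalerA. Qed.

Fact quot_scale1 : left_id 1 quot_scale.
Proof. by move=> x; rewrite -[x]quot_projK quot_scale_proj scale1r. Qed.

Fact quot_scaleDr : right_distributive quot_scale +%R.
Proof.
move=> a x y; rewrite -[x]quot_projK -[y]quot_projK.
by rewrite -quot_projD !quot_scale_proj scalerDr quot_projD.
Qed.

Fact quot_scaleDl x : {morph quot_scale^~ x : a b / a + b}.
Proof.
move=> a b; rewrite -[x]quot_projK !quot_scale_proj.
by rewrite scalerDl quot_projD.
Qed.

HB.instance Definition _ := GRing.Zmodule_isLmodule.Build R quot_module
  quot_scaleA quot_scale1 quot_scaleDr quot_scaleDl.

End QuotientModule.

Section Homological.
Variable R : comNzRingType.

Definition projective (P : lmodType R) : Prop :=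
  forall (M N : lmodType R) (g : {linear M -> N}) (f : {linear P -> N}),
    (forall y, exists x, g x = y) ->
    exists h : {linear P -> M}, forall x, g (h x) = f x.

Definition is_resolution (M : lmodType R) (P : nat -> lmodType R)
    (d : forall i, {linear P i.+1 -> P i}) (eps : {linear P 0%N -> M}) : Prop :=
  [/\ forall z, exists x, eps x = z,
      forall x, eps x = 0 <-> exists y, d 0%N y = x
    & forall i x, d i x = 0 <-> exists y, d i.+1 y = x].

Definition pd_le (M : lmodType R) (n : nat) : Prop :=
  exists (P : nat -> lmodType R) (d : forall i, {linear P i.+1 -> P i})
         (eps : {linear P 0%N -> M}),
    [/\ is_resolution d eps, forall i, projective (P i)
      & forall i, (n < i)%N -> forall x : P i, x = 0].

Definition pd_eq (M : lmodType R) (n : nat) : Prop :=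
  pd_le M n /\ forall k, pd_le M k -> (n <= k)%N.

(* The sequences are regular on R; the last clause is R <> (s)R. *)
Definition regular_sequence (s : seq R) : Prop :=
  (forall i, (i < size s)%N -> forall a : R,
     a * s`_i \in @span_of R R^o (take i s) ->
     a \in @span_of R R^o (take i s))
  /\ 1 \notin @span_of R R^o s.

(* The grade is the largest length of a regular sequence contained in I. *)
Definition grade_eq (I : submodClosed R^o) (g : nat) : Prop :=
  (exists s : seq R, [/\ regular_sequence s, {subset s <= I} & size s = g])
  /\ forall s : seq R, regular_sequence s -> {subset s <= I} ->
       (size s <= g)%N.

(* The grade of I equals the projective dimension of R / I. *)
Definition perfect_of_grade (I : submodClosed R^o) (g : nat) : Prop :=
  grade_eq I g /\ pd_eq (quot_module I) g.

Definition minimally_generated_by (I : submodClosed R^o) (k : nat) : Prop :=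
  (exists2 s : seq R, size s = k & I =i @span_of R R^o s)
  /\ forall s : seq R, I =i @span_of R R^o s -> (k <= size s)%N.

Definition almost_complete_intersection (I : submodClosed R^o) (g : nat) :=
  perfect_of_grade I g /\ minimally_generated_by I g.+1.

End Homological.

Section Graded.
Variables (R : comNzRingType) (n : nat) (W : zmodType) (wt : 'I_n -> W).
Local Notation S := {mpoly R[n]}.

Definition mwt (u : 'X_{1..n}) : W := \sum_i wt i *+ u i.

Definition whomog (w : W) (p : S) : Prop :=
  forall u, u \in msupp p -> mwt u = w.

(* F_i is the free module of row vectors of size b i, whose k-th basis vector
   has degree e i k; the maps are v |-> v *m D i. *)
Definition graded_free_resolution (I : submodClosed S^o) (b : nat -> nat)
    (e : forall i, 'I_(b i) -> W) (D : forall i, 'M[S]_(b i.+1, b i))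
    (eps : {linear 'rV[S]_(b 0%N) -> quot_module I}) : Prop :=
  [/\ @is_resolution S (quot_module I) (fun i => 'rV[S]_(b i))
        (fun i => mulmxr (D i)) eps,
      forall i k l, whomog (e i.+1 k - e i l) (D i k l)
    & forall k, exists2 a : S, whomog (e 0%N k) a
        & eps (delta_mx 0 k) = quot_proj I a].

(* The differentials have entries in the ideal generated by the variables. *)
Definition minimal_maps (b : nat -> nat) (D : forall i, 'M[S]_(b i.+1, b i)) :=
  forall i k l, (D i k l)@_0%MM = 0.

(* The free modules F_0, F_1, F_2, F_3 are numbered from the one covering the
   quotient ring, so the type is the rank b 3. It does not depend on the minimal resolution:
   b i is the rank of the free R-module Tor_i(S/I, R), where the variables act
   by 0 on R. *)
Definition has_type (I : submodClosed S^o) (t : nat) : Prop :=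
  exists (b : nat -> nat) (e : forall i, 'I_(b i) -> W)
         (D : forall i, 'M[S]_(b i.+1, b i))
         (eps : {linear 'rV[S]_(b 0%N) -> quot_module I}),
    [/\ graded_free_resolution e D eps, minimal_maps D & b 3%N = t].

End Graded.

Section Exterior.
Variables (R : comNzRingType) (d : nat).

(* The exterior algebra of R^d: x T is the coefficient of the wedge of the
   g_i, i in T, taken in increasing order. *)
Definition extalg := {ffun {set 'I_d} -> R^o}.

Definition ext_gen (i : 'I_d) : extalg := [ffun T : {set 'I_d} => (T == [set i])%:R].

(* (-1) ^+ ninv T U is the sign of the shuffle sorting T followed by U. *)
Definition ninv (T U : {set 'I_d}) : nat :=
  #|[set p in setX T U | (p.2 < p.1)%N]|.

Definition wedge (x y : extalg) : extalg :=
  [ffun T : {set 'I_d} => \sum_(U : {set 'I_d} | U \subset T)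
               (-1) ^+ ninv U (T :\: U) * x U * y (T :\: U)].

Definition ext_top (x : extalg) : R := x setT.

(* Permutations listing a perfect matching of 0, ..., n-1, for n even, as
   s 0 < s 1, s 2 < s 3, ... with s 0 < s 2 < s 4 < ... *)
Definition matching_perm n (s : 'S_n) : bool :=
  [forall i : 'I_n, ~~ odd i ==> (s i < s (ordS i))%N] &&
  [forall i : 'I_n, forall j : 'I_n,
     [&& ~~ odd i, ~~ odd j & (i < j)%N] ==> (s i < s j)%N].

Definition Pf n (A : 'M[R]_n) : R :=
  if odd n then 0 else
  \sum_(s : 'S_n | matching_perm s)
     (-1) ^+ s * \prod_(i < n | ~~ odd i) A (s i) (s (ordS i)).

(* Pfaffian of the submatrix on T; enum_val lists T in increasing order. *)
Definition subPf (A : 'M[R]_d) (T : {set 'I_d}) : R :=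
  Pf (mxsub (@enum_val _ (mem T)) (@enum_val _ (mem T)) A).

(* The j-th divided power of \sum_(i < k) A i k g_i /\ g_k, for A alternating. *)
Definition ext_divpow (A : 'M[R]_d) (j : nat) : extalg :=
  [ffun T : {set 'I_d} => if #|T| == (2 * j)%N then subPf A T else 0].

End Exterior.

Section Generic.
Variable d : nat.

(* inl (i, j) stands for c_ij, i < j, and inr (k, i) for u_ki. *)
Definition var : finType :=
  ({p : 'I_d * 'I_d | (p.1 < p.2)%N} + 'I_3 * 'I_d)%type.

Definition nvar : nat := #|var|.
Local Notation polA := {mpoly int[nvar]}.

Definition Xvar (v : var) : polA := 'X_(enum_rank v).

Definition bideg (i : 'I_nvar) : int * int :=
  match enum_val i with inl _ => (1, 0) | inr _ => (0, 1) end.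

Definition generic_skew : 'M[polA]_d :=
  \matrix_(i, j)
    if insub (i, j) is Some p then Xvar (inl p)
    else if insub (j, i) is Some p then - Xvar (inl p) else 0.

Definition generic_power (j : nat) : extalg polA d :=
  ext_divpow generic_skew j.

Definition generic_vec (k : 'I_3) : extalg polA d :=
  \sum_(i < d) Xvar (inr (k, i)) *: ext_gen _ i.

End Generic.

Section IdealI.
Variable m : nat.
Local Notation d := (2 * m)%N.
Local Notation C := (generic_power d).
(* The indices k = 1, 2, 3 are stored in 'I_3 as 0, 1, 2. *)
Local Notation u k := (generic_vec d (inord k.-1)).
Local Notation "x ^^ y" := (wedge x y) (at level 40, left associativity).

Definition idealI_gens : seq {mpoly int[nvar d]}^o :=
  [:: ext_top (C m);
      ext_top (C m.-1 ^^ u 1 ^^ u 2);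
      ext_top (C m.-1 ^^ u 1 ^^ u 3);
      ext_top (C m.-1 ^^ u 2 ^^ u 3)].

Definition idealI : submodClosed {mpoly int[nvar d]}^o := span_of idealI_gens.

End IdealI.

(* Main.v *)
Require Import Defs.
From HB Require Import structures.
From mathcomp Require Import all_boot all_order all_algebra all_fingroup.
From mathcomp Require Import generic_quotient boolp mpoly ring zify.

Set Implicit Arguments.
Unset Strict Implicit.
Unset Printing Implicit Defensive.

Import GRing.Theory.
Local Open Scope ring_scope.

Local Notation ideal_span s := (@span_of _ (_^o) s).

(** Let A be the generic alternating matrix of size d = 2m, p its Pfaffian,
    u_1, u_2, u_3 the generic vectors, and E the sum of all divided powers of
    the bivector C.  For vectors v_1, ..., v_r let [v_1 ... v_r] be the
    coefficient of g_1 /\ ... /\ g_d in v_1 /\ ... /\ v_r /\ E.  The ideal I is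
    generated by p = [] and the three brackets [u_k u_l].  Its quotient ring
    has the resolution

      0 -> S^d -> S^(d+3) -> S^4 -> S,

    whose leftmost map is (A | -U^T), the rightmost one having the entries p
    and x = ([u_2 u_3], [u_3 u_1], [u_1 u_2]), and the middle one being built
    from the brackets z_i = [u_1 u_2 u_3 g_i] and w_ki = [u_k g_i].  It is the
    mapping cone that links I, through the three [u_k u_l], to the Gorenstein
    ideal of submaximal Pfaffians of the alternating matrix of size d + 3 with
    blocks A, U^T, -U and 0.

    All identities between brackets come from one source.  Contraction by the
    k-th coordinate sends E to a_k /\ E, a_k the k-th row of A, and no
    contraction has a component in top degree; so contracting
    v_1 /\ ... /\ v_r /\ E and reading off the top coefficient expresses
    [v_1 ... v_r a_k] by shorter brackets.  These identities give that the
    maps above form a complex and, more importantly, that multiplication by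
    each generator of I is null-homotopic on it, by explicit homotopies whose
    entries are again brackets ([contracts_pf], [contracts_xvec]).

    The homological conclusions follow from an elementary form of the
    acyclicity lemma ([exact_of_nullhomotopic]): if the members of a regular
    sequence of length r act null-homotopically on a cochain complex of free
    modules, the complex is exact in its first r places.  Applied to the
    complex above and a regular sequence of length three it gives the
    resolution.  Applied to the dual complex it bounds the grade: a regular
    sequence of length four in I would make the transpose of (A | -U^T)
    surjective, which its lack of constant terms forbids.  The same
    obstruction excludes a projective resolution of length two, since
    comparison with it would split the leftmost map ([split_of_pd_le2]).  As
    the syzygies of the four generators have no constant terms either, four
    generators are needed, and the resolution, being minimal and bigraded,
    shows that the type is d.

    It remains to see that p, [u_1 u_2], [u_1 u_3] is a regular sequence.
    Keep only the variables c_(i,i+1), the two extreme coordinates of u_1, the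
    last coordinate of u_2 and all of u_3.  The parts of the three polynomials
    involving kept variables only are their leading forms for the degree in
    the kept variables, and regularity may be tested on them
    ([regular2_of_top], [regular3_of_top]).  The specialized matrix is
    tridiagonal, so the first two leading forms are, up to sign, coprime
    squarefree monomials; the third one is regular modulo them because it does
    not vanish on any coordinate subspace where one variable of each monomial is
    zero, as an integral point on each of these subspaces shows
    ([restrict_x02_neq0]). *)

(** * Ideals generated by finite sequences *)

Section Ideals.
Variable R : comNzRingType.
Implicit Types (s : seq R) (a b x : R).

Lemma ideal_spanP s x :
  reflect (exists a : 'I_(size s) -> R, x = \sum_i a i * s`_i)
          (x \in ideal_span s).
Proof. exact: asboolP. Qed.

Lemma mem_ideal_span s x : x \in s -> x \in ideal_span s.
Proof.
move=> /(nthP 0)[i lis <-]; apply/ideal_spanP.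
exists (fun j => (j == Ordinal lis)%:R).
rewrite (bigD1 (Ordinal lis)) //= eqxx mul1r big1 ?addr0 // => j /negbTE->.
by rewrite mul0r.
Qed.

Lemma ideal_spanM s a x :
  x \in ideal_span s -> a * x \in ideal_span s.
Proof. exact: (@rpredZ _ _ (ideal_span s) a x). Qed.

Lemma ideal_span_sum s (I : Type) (r : seq I) (P : pred I) (F : I -> R) :
  (forall i, P i -> F i \in ideal_span s) ->
  \sum_(i <- r | P i) F i \in ideal_span s.
Proof. exact: (@rpred_sum _ (ideal_span s)). Qed.

Lemma ideal_spanD s a b :
  a \in ideal_span s -> b \in ideal_span s ->
  a + b \in ideal_span s.
Proof. exact: (@rpredD _ (ideal_span s)). Qed.

Lemma sub_ideal_span s (J : submodClosed R^o) :
  {subset s <= J} -> {subset ideal_span s <= J}.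
Proof.
move=> sJ x /ideal_spanP[a ->]; apply: rpred_sum => i _.
by apply: (@rpredZ _ R^o J); apply/sJ/mem_nth.
Qed.

Lemma ideal_span_nil x : x \in ideal_span [::] -> x = 0.
Proof. by case/ideal_spanP=> a ->; rewrite big_ord0. Qed.

Lemma ideal_span_rcons s c x :
  x \in ideal_span (rcons s c) <->
  exists t, x - t * c \in ideal_span s.
Proof.
split=> [|[t xt]].
  move: x; have cl: submod_closed
      (fun x : R^o => `[< exists t, x - t * c \in ideal_span s >]).
    split=> [|a u v /asboolP[t ut] /asboolP[t' vt']]; apply/asboolP.
      by exists 0; rewrite mul0r subr0; apply: (@rpred0 _ (ideal_span s)).
    exists (a * t + t').
    have -> : a *: u + v - (a * t + t') * c = a * (u - t * c) + (v - t' * c).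
      by rewrite mulrDl mulrBr opprD addrACA mulrA.
    by apply: ideal_spanD => //; apply: ideal_spanM.
  move=> x /ideal_spanP[a ->].
  apply/asboolP.
  apply: (@big_ind R (fun z => `[< exists t, z - t * c \in ideal_span s >])) => [||i _].
  - exact: cl.1.
  - by move=> y z yP zP; have := cl.2 1 y z yP zP; rewrite scale1r.
  apply/asboolP; have := ltn_ord i.
  rewrite [X in (_ < X)%N]size_rcons ltnS nth_rcons.
  case: ltngtP => // [lis _ | _ _].
    by exists 0; rewrite mul0r subr0; apply/ideal_spanM/mem_ideal_span/mem_nth.
  by exists (a i); rewrite subrr; apply: (@rpred0 _ (ideal_span s)).
rewrite -[x](subrK (t * c)); apply: ideal_spanD; last first.
  by apply/ideal_spanM/mem_ideal_span; rewrite mem_rcons mem_head.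
apply: (sub_ideal_span _ xt) => y ys; apply: mem_ideal_span.
by rewrite mem_rcons inE ys orbT.
Qed.

End Ideals.

(** * Exactness from null-homotopies and a regular sequence *)

Section NullHomotopies.
Variables (R : comNzRingType) (g : nat -> nat).
Variable D : forall i, 'M[R]_(g i, g i.+1).

Definition nullhomotopic (f : R) : Prop :=
  exists H : forall i, 'M[R]_(g i.+1, g i),
    forall i, f%:M = D i.+1 *m H i.+1 + H i *m D i.

Definition congr_mod (J : {pred R}) m n (v w : 'M[R]_(m, n)) :=
  forall i j, (v - w) i j \in J.

(** The modules g 1, g 2, ... sit in cohomological degrees 0, 1, ...; the zero
    module g 0 in front spares a special case for the first one.  The claim is
    that cohomology modulo s_0, ..., s_(k-1) vanishes in degree i once
    k + i < size s, and the induction trades one degree for one member of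
    the sequence: for a cocycle v the homotopy H of s_k turns s_k v into the
    coboundary of v H, so that v H is a cocycle modulo s_k as well and is, by
    induction, a coboundary modulo s_k; dividing by s_k, which is regular,
    shows that v is a coboundary. *)
Lemma exact_of_nullhomotopic (s : seq R) :
    g 0 = 0%N -> (forall i, D i *m D i.+1 = 0) ->
    regular_sequence s -> {in s, forall f, nullhomotopic f} ->
  forall i k, (k + i < size s)%N -> forall v : 'rV[R]_(g i.+1),
    congr_mod (ideal_span (take k s)) (v *m D i.+1) 0 ->
    exists y : 'rV_(g i), congr_mod (ideal_span (take k s)) v (y *m D i).
Proof.
move=> g0 DD [sreg _] sH i.
have mulJ (J : submodClosed R^o) m n p (v : 'M[R]_(m, n)) (M : 'M[R]_(n, p)) :
    (forall i j, v i j \in J) -> forall i j, (v *m M) i j \in J.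
  move=> vJ a b; rewrite mxE; apply: rpred_sum => c _.
  by rewrite mulrC; apply: (@rpredZ _ R^o J).
elim: i => [|i IHi] k; rewrite ?addn0 => lt_ks v vD.
  have [H fH] := sH _ (mem_nth 0 lt_ks).
  exists 0 => a j; rewrite mul0mx subr0.
  apply: sreg => //.
  have -> : v a j * s`_k = (v *m D 1 *m H 1%N) a j.
    (* An empty sum, as g 0 = 0. *)
  have H0 : H 0 *m D 0 = 0.
      apply/matrixP=> x y; rewrite !mxE big1 // => z.
      by have := ltn_ord z; rewrite [X in (_ < X)%N]g0.
    by rewrite -mulmxA -[D 1 *m _]addr0 -H0 -fH mul_mx_scalar mxE mulrC.
  by apply: mulJ => x y; have := vD x y; rewrite subr0.
have lt_k: (k < size s)%N by apply: leq_ltn_trans lt_ks; rewrite leq_addr.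
have [H fH] := sH _ (mem_nth 0 lt_k).
set J := ideal_span (take k s) in vD *.
set J' := ideal_span (take k.+1 s).
have J'E x : x \in J' <-> exists t, x - t * s`_k \in J.
  by rewrite /J' (take_nth 0 lt_k); apply: ideal_span_rcons.
(* The error term of the homotopy, zero modulo the sequence because v is a
   cocycle there. *)
set w := v *m D i.+2 *m H i.+2.
have wJ a j : w a j \in J by apply: mulJ => x y; have := vD x y; rewrite subr0.
have ED : v *m H i.+1 *m D i.+1 = s`_k *: v - w.
  by rewrite -mul_mx_scalar fH mulmxDr /w !mulmxA addrC addKr.
have /IHi IHk : (k.+1 + i < size s)%N by rewrite addSnnS.
have [|z zP] := IHk (v *m H i.+1).
  move=> a j; rewrite subr0 ED; apply/J'E; exists (v a j).
  rewrite !mxE mulrC addrAC subrr add0r.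
  by apply: (@rpredNr _ J); have := wJ a j; rewrite mxE.
have /choice[t tP] j : exists t, (v *m H i.+1 - z *m D i) 0 j - t * s`_k \in J.
  exact/J'E/zP.
exists (\row_j t j) => a j; apply: sreg => //; rewrite -/J.
set x := v *m H i.+1 - z *m D i - s`_k *: \row_j t j.
have xJ b l : x b l \in J.
  by have := tP l; rewrite !ord1 /x !mxE [t l * _]mulrC.
have := mulJ J _ _ _ x (D i.+1) xJ a j.
rewrite /x !mulmxBl -[z *m _ *m _]mulmxA DD mulmx0 subr0 ED -scalemxAl => yJ.
have -> : (v - (\row_j t j) *m D i.+1) a j * s`_k
   = (s`_k *: v - w - s`_k *: ((\row_j t j) *m D i.+1)) a j + w a j.
  by rewrite !mxE; ring.
exact: rpredD.
Qed.

End NullHomotopies.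

(** * Comparison of projective resolutions *)

Section LinearMaps.
Variable R : comNzRingType.

(** Lets a plain function be proved linear inside a proof and then be used
    where a bundled linear map is required. *)
Lemma linear_bundle (U V : lmodType R) (h : U -> V) :
  linear h -> exists h' : {linear U -> V}, h' =1 h.
Proof.
by move=> lin; exists (HB.pack_for {linear U -> V} h (GRing.isLinear.Build R U V *:%R h lin)).
Qed.

Definition ker_of (M N : lmodType R) (g : {linear M -> N}) : {pred M} :=
  fun x => g x == 0.

Fact ker_of_submod_closed (M N : lmodType R) (g : {linear M -> N}) :
  submod_closed (ker_of g).
Proof.
split=> [|a u v]; rewrite /ker_of !unfold_in ?linear0 // => /eqP gu /eqP gv.
by rewrite linearP gu gv scaler0 addr0.
Qed.

HB.instance Definition _ (M N : lmodType R) (g : {linear M -> N}) :=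
  GRing.isSubmodClosed.Build R M (ker_of g) (ker_of_submod_closed g).

Fact quot_proj_linear (V : lmodType R) (U : submodClosed V) :
  linear (quot_proj U).
Proof. by move=> a u v; rewrite quot_projD -quot_scale_proj. Qed.

HB.instance Definition _ (V : lmodType R) (U : submodClosed V) :=
  GRing.isLinear.Build R V (quot_module U) _ (quot_proj U) (quot_proj_linear U).

Lemma quot_proj_eq0 (V : lmodType R) (U : submodClosed V) v :
  quot_proj U v = 0 <-> v \in U.
Proof.
have proj0 : quot_proj U 0 = 0 by exact: linear0.
split=> [v0|vU].
  by have /quot_projP := etrans v0 (esym proj0); rewrite subr0.
by apply: etrans proj0; apply/quot_projP; rewrite subr0.
Qed.

(** Projectivity is stated for surjections only.  Replacing N by M / ker g
    gives a surjection from M, through which f still factors because its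
    values lie in the image of g. *)
Lemma lift_projective (P M N : lmodType R) (f : {linear P -> N})
    (g : {linear M -> N}) :
  projective P -> (forall x, exists y, g y = f x) ->
  exists h : {linear P -> M}, forall x, g (h x) = f x.
Proof.
move=> projP /choice[c gc].
have [|f' f'E] := @linear_bundle P (quot_module (ker_of g))
                    (fun x => quot_proj (ker_of g) (c x)).
  move=> a u v; rewrite -linearP; apply/quot_projP.
  by rewrite unfold_in /ker_of linearB linearP !gc linearP subrr.
have [|h hE] := projP _ _ (quot_proj (ker_of g)) f'.
  by move=> y; exists (repr y); apply: quot_projK.
exists h => x; have /quot_projP := etrans (hE x) (f'E x).
by rewrite unfold_in /ker_of linearB gc subr_eq0 => /eqP.
Qed.

Lemma projective_rV n : projective 'rV[R]_n.
Proof.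
move=> M N g f gsurj; have [c gc] := choice (fun i => gsurj (f (delta_mx 0 i))).
have [|h hE] := @linear_bundle 'rV[R]_n M (fun v => \sum_i v 0 i *: c i).
  move=> a u v; rewrite scaler_sumr -big_split; apply: eq_bigr => i _.
  by rewrite !mxE scalerDl scalerA.
exists h => v; rewrite hE linear_sum [in RHS](row_sum_delta v) linear_sum.
by apply: eq_bigr => i _; rewrite !linearZ gc.
Qed.

Lemma pd_leW (M : lmodType R) k n : (k <= n)%N -> pd_le M k -> pd_le M n.
Proof.
move=> lekn [P [d [eps [res proj P0]]]]; exists P, d, eps; split=> // i ltni.
by apply: P0; apply: leq_ltn_trans ltni.
Qed.

(** The comparison maps a : F -> P and b : P -> F lift the identity of M, and
    b a is homotopic to the identity.  As P 3 = 0, the map b_2 a_2 kills the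
    image of d 2, so that the homotopy h2 : F 2 -> F 3 satisfies
    d 2 (h2 (d 2 x) + x) = 0; and d 2 is injective because F 4 = 0. *)
Lemma split_of_pd_le2 (M : lmodType R) (F : nat -> lmodType R)
    (d : forall i, {linear F i.+1 -> F i}) (eps : {linear F 0 -> M}) :
    is_resolution d eps -> (forall i, projective (F i)) ->
    (forall x : F 4, x = 0) -> pd_le M 2 ->
  exists h : {linear F 2 -> F 3}, forall x, h (d 2 x) = x.
Proof.
move=> [eps_surj d0 dS] projF F4 [P [p [eta [[eta_surj p0 pS] projP Pgt2]]]].
have P3 := Pgt2 3 isT.
have eps_d x : eps (d 0 x) = 0 by apply/d0; exists x.
have dd i x : d i (d i.+1 x) = 0 by apply/dS; exists x.
have eta_p x : eta (p 0 x) = 0 by apply/p0; exists x.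
have pp i x : p i (p i.+1 x) = 0 by apply/pS; exists x.
have [a0 a0E] := lift_projective (projF 0) (fun x => eta_surj (eps x)).
have [b0 b0E] := lift_projective (projP 0) (fun x => eps_surj (eta x)).
have [a1 a1E] : exists h : {linear F 1 -> P 1}, forall x, p 0 (h x) = a0 (d 0 x).
  apply: (@lift_projective _ _ _ (a0 \o d 0)) => // x.
  by apply/p0; rewrite /= a0E eps_d.
have [b1 b1E] : exists h : {linear P 1 -> F 1}, forall x, d 0 (h x) = b0 (p 0 x).
  apply: (@lift_projective _ _ _ (b0 \o p 0)) => // x.
  by apply/d0; rewrite /= b0E eta_p.
have [a2 a2E] : exists h : {linear F 2 -> P 2}, forall x, p 1 (h x) = a1 (d 1 x).
  apply: (@lift_projective _ _ _ (a1 \o d 1)) => // x.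
  by apply/pS; rewrite /= a1E dd linear0.
have [b2 b2E] : exists h : {linear P 2 -> F 2}, forall x, d 1 (h x) = b1 (p 1 x).
  apply: (@lift_projective _ _ _ (b1 \o p 1)) => // x.
  by apply/dS; rewrite /= b1E pp linear0.
have [h0 h0E] : exists h : {linear F 0 -> F 1}, forall x, d 0 (h x) = b0 (a0 x) - x.
  apply: (@lift_projective _ _ _ ((b0 \o a0) \- idfun)) => // x.
  by apply/d0; rewrite /= linearB b0E a0E subrr.
have [h1 h1E] : exists h : {linear F 1 -> F 2},
    forall x, d 1 (h x) = b1 (a1 x) - x - h0 (d 0 x).
  apply: (@lift_projective _ _ _ (((b1 \o a1) \- idfun) \- (h0 \o d 0))) => // x.
  by apply/dS; rewrite /= !linearB /= b1E a1E h0E subrr.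
have [h2 h2E] : exists h : {linear F 2 -> F 3},
    forall x, d 2 (h x) = b2 (a2 x) - x - h1 (d 1 x).
  apply: (@lift_projective _ _ _ (((b2 \o a2) \- idfun) \- (h1 \o d 1))) => // x.
  by apply/dS; rewrite /= !linearB /= b2E a2E h1E dd linear0 subr0 subrr.
have [h hE] := @linear_bundle (F 2) (F 3) (fun x => - h2 x)
  (fun a u v => etrans (congr1 -%R (linearP h2 a u v))
     (etrans (opprD _ _) (congr1 (+%R^~ _) (esym (scalerN _ _))))).
exists h => x; rewrite hE; apply/eqP; rewrite -subr_eq0 -opprD oppr_eq0; apply/eqP.
have /dS[y <-] : d 2 (h2 (d 2 x) + x) = 0.
  have a2d : a2 (d 2 x) = 0.
    have /pS[y <-] : p 1 (a2 (d 2 x)) = 0 by rewrite a2E dd linear0.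
    by rewrite (P3 y) linear0.
  by rewrite linearD /= h2E a2d dd [b2 0]linear0 [h1 0]linear0 subr0 add0r addNr.
by rewrite (F4 y) linear0.
Qed.

End LinearMaps.

(** * Complexes of length three contracted by an ideal *)

Section LengthThree.
Variable R : comNzRingType.

(** The zero module in position 0 is the one required by
    [exact_of_nullhomotopic]. *)
Definition cochain_dim (a b c d i : nat) : nat :=
  match i with 1 => a | 2 => b | 3 => c | 4 => d | _ => 0 end.

Definition cochain_diff a b c d (A : 'M[R]_(a, b)) (B : 'M[R]_(b, c))
    (C : 'M[R]_(c, d)) (i : nat) :
    'M[R]_(cochain_dim a b c d i, cochain_dim a b c d i.+1) :=
  match i with 1 => A | 2 => B | 3 => C | _ => 0 end.

(** Multiplication by f is null-homotopic on the complex of row vectors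
    R^a -> R^b -> R^c -> R^d. *)
Definition contracts a b c d (A : 'M[R]_(a, b)) (B : 'M[R]_(b, c))
    (C : 'M[R]_(c, d)) (f : R) : Prop :=
  exists (H : 'M[R]_(b, a)) (K : 'M[R]_(c, b)) (L : 'M[R]_(d, c)),
    [/\ A *m H = f%:M, B *m K + H *m A = f%:M, C *m L + K *m B = f%:M
      & L *m C = f%:M].

(** Homotopies transpose, so the elements that contract a complex also
    contract its dual. *)
Lemma contracts_tr a b c d (A : 'M[R]_(a, b)) (B : 'M[R]_(b, c))
    (C : 'M[R]_(c, d)) f :
  contracts A B C f -> contracts C^T B^T A^T f.
Proof.
move=> [H [K [L [AH BK CL LC]]]]; exists L^T, K^T, H^T.
by split; rewrite -!trmx_mul -?raddfD /= ?AH ?LC 1?addrC ?BK ?CL tr_scalar_mx.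
Qed.

Lemma contracts_nullhomotopic a b c d (A : 'M[R]_(a, b)) (B : 'M[R]_(b, c))
    (C : 'M[R]_(c, d)) f :
  contracts A B C f -> nullhomotopic (cochain_diff A B C) f.
Proof.
move=> [H [K [L [AH BK CL LC]]]].
exists (fun i => match i return 'M[R]_(cochain_dim a b c d i.+1, cochain_dim a b c d i)
  with 1 => H | 2 => K | 3 => L | _ => 0 end).
case=> [|[|[|[|i]]]] /=.
- by rewrite mulmx0 addr0 AH.
- by rewrite BK.
- by rewrite CL.
- by rewrite mul0mx add0r LC.
- by apply/matrixP=> x; have := ltn_ord x.
Qed.

Lemma contracts_span a b c d (A : 'M[R]_(a, b)) (B : 'M[R]_(b, c))
    (C : 'M[R]_(c, d)) (s : seq R) :
  {in s, forall f, contracts A B C f} ->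
  {in ideal_span s, forall f, contracts A B C f}.
Proof.
move=> sH f /ideal_spanP[k ->].
apply: (@big_ind R (contracts A B C)) => [||i _].
- by exists 0, 0, 0; split; rewrite !(mulmx0, mul0mx) ?addr0 raddf0.
- move=> x y [H [K [L [AH BK CL LC]]]] [H' [K' [L' [AH' BK' CL' LC']]]].
  exists (H + H'), (K + K'), (L + L').
  split; rewrite [RHS]raddfD /=.
  - by rewrite mulmxDr AH AH'.
  - by rewrite mulmxDr mulmxDl addrACA BK BK'.
  - by rewrite mulmxDr mulmxDl addrACA CL CL'.
  - by rewrite mulmxDl LC LC'.
have [H [K [L [AH BK CL LC]]]] := sH _ (mem_nth 0 (ltn_ord i)).
exists (k i *: H), (k i *: K), (k i *: L).
by split; rewrite -?scalemxAl -?scalemxAr -?scalerDr ?AH ?BK ?CL ?LC scale_scalar_mx.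
Qed.

Lemma congr_mod0 (m n : nat) (v w : 'M[R]_(m, n)) :
  congr_mod (@span_of R R^o [::]) v w <-> v = w.
Proof.
split=> [vw|-> i j]; last by rewrite subrr mxE; apply: rpred0.
apply/matrixP=> i j; apply/eqP; rewrite -subr_eq0; apply/eqP.
by have := ideal_span_nil (vw i j); rewrite !mxE.
Qed.

Lemma exact_of_contracts a b c d (A : 'M[R]_(a, b)) (B : 'M[R]_(b, c))
    (C : 'M[R]_(c, d)) (s : seq R) :
    A *m B = 0 -> B *m C = 0 -> regular_sequence s ->
    {in s, forall f, contracts A B C f} ->
  [/\ (0 < size s)%N -> forall v : 'rV_a, v *m A = 0 -> v = 0,
      (1 < size s)%N -> forall v : 'rV_b, v *m B = 0 -> exists y, v = y *m A,
      (2 < size s)%N -> forall v : 'rV_c, v *m C = 0 -> exists y, v = y *m B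
    & (3 < size s)%N -> forall v : 'rV_d, exists y, v = y *m C].
Proof.
move=> AB BC sreg sH.
have ex i : (i < size s)%N ->
    forall v : 'rV_(cochain_dim a b c d i.+1),
      v *m cochain_diff A B C i.+1 = 0 ->
      exists y, v = y *m cochain_diff A B C i.
  move=> lt_is v vD; have [||f sf||y yv] :=
    @exact_of_nullhomotopic R _ (cochain_diff A B C) s _ _ sreg _ i 0 lt_is v.
  - by [].
  - by case=> [|[|[|[|i']]]] //=; rewrite ?mul0mx ?mulmx0.
  - exact/contracts_nullhomotopic/sH.
  - by rewrite take0; apply/congr_mod0.
  by exists y; move: yv; rewrite take0 => /congr_mod0.
split=> lt_s v => [vA|vB|vC|].
- by have [y ->] := ex 0 lt_s v vA; rewrite mulmx0.
- exact: (ex 1 lt_s v vB).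
- exact: (ex 2 lt_s v vC).
- by apply: (ex 3 lt_s v); rewrite mulmx0.
Qed.

Definition res_dim (n1 n2 n3 i : nat) : nat :=
  match i with 0 => 1 | 1 => n1 | 2 => n2 | 3 => n3 | _ => 0 end.

Definition res_diff n1 n2 n3 (D1 : 'M[R]_(n1, 1)) (D2 : 'M[R]_(n2, n1))
    (D3 : 'M[R]_(n3, n2)) (i : nat) :
    'M[R]_(res_dim n1 n2 n3 i.+1, res_dim n1 n2 n3 i) :=
  match i with 0 => D1 | 1 => D2 | 2 => D3 | _ => 0 end.

Lemma augmentation_exists (I : submodClosed R^o) :
  exists eps : {linear 'rV[R]_1 -> quot_module I},
    forall v, eps v = quot_proj I (v 0 0).
Proof.
apply: (@linear_bundle R 'rV[R]_1 (quot_module I) (fun v => quot_proj I (v 0 0))).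
by move=> a u v; rewrite !mxE linearP.
Qed.

Section Perfection.
Variables (n1 n2 n3 : nat) (D1 : 'M[R]_(n1, 1)) (D2 : 'M[R]_(n2, n1)).
Variables (D3 : 'M[R]_(n3, n2)) (gens : seq R) (s : seq R).
Local Notation I := (@span_of R R^o gens).

Hypothesis D1E : forall x, x \in I <-> exists y : 'rV_n1, x = (y *m D1) 0 0.
Hypothesis D21 : D2 *m D1 = 0.
Hypothesis D32 : D3 *m D2 = 0.
Hypothesis contrI : {in gens, forall f, contracts D3 D2 D1 f}.
Hypothesis s_reg : regular_sequence s.
Hypothesis s_size : size s = 3.
Hypothesis sI : {subset s <= I}.

Variables (T : comNzRingType) (aug : {rmorphism R -> T}).
Hypothesis D2_min : map_mx aug D2 = 0.
Hypothesis D3_min : map_mx aug D3 = 0.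
Hypothesis n3_gt0 : (0 < n3)%N.

Local Lemma exactD :
  [/\ forall v : 'rV_n3, v *m D3 = 0 -> v = 0,
      forall v : 'rV_n2, v *m D2 = 0 -> exists y, v = y *m D3
    & forall v : 'rV_n1, v *m D1 = 0 -> exists y, v = y *m D2].
Proof.
have [|E3 E2 E1 _] := exact_of_contracts D32 D21 s_reg.
  by move=> f /sI fI; apply: contracts_span fI.
by split; [apply: E3 | apply: E2 | apply: E1]; rewrite s_size.
Qed.

Lemma resolution_of_contracts (eps : {linear 'rV[R]_1 -> quot_module I}) :
    (forall v, eps v = quot_proj I (v 0 0)) ->
  @is_resolution R (quot_module I) (fun i => 'rV[R]_(res_dim n1 n2 n3 i))
    (fun i => mulmxr (res_diff D1 D2 D3 i)) eps.
Proof.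
move=> epsE; have [E3 E2 E1] := exactD; split.
- move=> z; exists (const_mx (repr z)); rewrite epsE mxE; exact: quot_projK.
- move=> x; rewrite epsE /=.
  rewrite quot_proj_eq0.
  rewrite D1E; split=> -[y xy]; exists y; last by rewrite -xy.
  by apply/matrixP=> i j; rewrite !ord1 xy.
- case=> [|[|[|i]]] x /=; split.
  + by case/E1=> y ->; exists y.
  + by case=> y <-; rewrite -mulmxA D21 mulmx0.
  + by case/E2=> y ->; exists y.
  + by case=> y <-; rewrite -mulmxA D32 mulmx0.
  + by move/E3=> ->; exists 0; rewrite mul0mx.
  + by case=> y <-; rewrite mulmx0 mul0mx.
  + by move=> _; exists 0; apply/matrixP=> ? [].
  + by move=> _; rewrite mulmx0.
Qed.

(** Both the bound on the grade and the one on the projective dimension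
    reduce to this: after applying aug, a right inverse of D3 would be a right
    inverse of zero. *)
Local Lemma D3_nosection (Y : 'M_(n2, n3)) : D3 *m Y = 1%:M -> False.
Proof.
move=> /(congr1 (map_mx aug)); rewrite map_mxM D3_min mul0mx map_mx1.
move=> /matrixP/(_ (Ordinal n3_gt0) (Ordinal n3_gt0)); rewrite !mxE eqxx => /eqP.
by rewrite eq_sym oner_eq0.
Qed.

(** Four elements of a regular sequence in the ideal would make the dual
    complex exact at its last module, and preimages of the unit vectors under
    the transpose of D3 assemble to a right inverse of D3. *)
Lemma grade_of_contracts : grade_eq I 3.
Proof.
split; first by exists s.
move=> t t_reg tI; rewrite leqNgt; apply/negP=> t_gt3.
have [|||_ _ _ /(_ t_gt3) E] := @exact_of_contracts _ _ _ _ D1^T D2^T D3^T t _ _ t_reg.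
- by rewrite -trmx_mul D21 trmx0.
- by rewrite -trmx_mul D32 trmx0.
- by move=> f /tI fI; apply/contracts_tr/(contracts_span contrI fI).
have [y yE] := choice (fun i => E (row i 1%:M)).
apply: (@D3_nosection (\matrix_i y i)^T).
apply: trmx_inj; rewrite trmx_mul trmxK trmx1.
by apply/row_matrixP=> i; rewrite row_mul rowK yE.
Qed.

Lemma pd_of_contracts : pd_eq (quot_module I) 3.
Proof.
have [eps epsE] := augmentation_exists I.
have res := resolution_of_contracts epsE; split.
  exists (fun i => 'rV[R]_(res_dim n1 n2 n3 i)).
  exists (fun i => mulmxr (res_diff D1 D2 D3 i)), eps; split=> //.
  - by move=> i; apply: projective_rV.
  - by case=> [|[|[|[|i]]]] // _ x; apply/matrixP=> ? [].
move=> k pdk; rewrite leqNgt; apply/negP=> lt_k3.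
have [||h hE] := split_of_pd_le2 res _ _ (pd_leW (lt_k3 : (k <= 2)%N) pdk).
- by move=> i; apply: projective_rV.
- by move=> x; apply/matrixP=> ? [].
apply: (@D3_nosection (lin1_mx h)); apply/row_matrixP=> i.
by rewrite row_mul mul_rV_lin1 row1 rowE; apply: hE.
Qed.

(** If t generates the ideal, write D1 = B t and t = A D1.  Then the rows of
    1 - B A are syzygies of D1, hence combinations of the rows of D2, and
    aug makes B a left factor of the identity of size n1 through size t. *)
Lemma minimal_of_contracts : size gens = n1 -> minimally_generated_by I n1.
Proof.
move=> gens_size; split; first by exists gens.
move=> t It.
have /choice[a aE] (i : 'I_(size t)) : exists y : 'rV_n1, t`_i = (y *m D1) 0 0.
  by apply/D1E; rewrite It; apply/mem_ideal_span/mem_nth.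
have /choice[b bE] (j : 'I_n1) : exists y : 'I_(size t) -> R, D1 j 0 = \sum_i y i * t`_i.
  apply/ideal_spanP; rewrite -It; apply/D1E; exists (delta_mx 0 j).
  by rewrite -rowE mxE.
pose A := \matrix_i a i; pose B := \matrix_(j, i) b j i.
have BAD : B *m A *m D1 = D1.
  apply/matrixP=> j k; rewrite !ord1 bE -mulmxA mxE; apply: eq_bigr => i _.
  by rewrite mxE aE -(rowK a i) -row_mul [in RHS]mxE.
have [_ _ E1] := exactD.
have /choice[y yE] j : exists y, row j (1%:M - B *m A) = y *m D2.
  by apply: E1; rewrite -row_mul mulmxBl mul1mx BAD subrr linear0.
have /(congr1 (map_mx aug)) : 1%:M - B *m A = (\matrix_j y j) *m D2.
  by apply/row_matrixP=> j; rewrite row_mul rowK yE.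
rewrite map_mxM D2_min mulmx0 map_mxB map_mx1 map_mxM => /eqP.
by rewrite subr_eq0 eq_sym => /eqP/mulmx1_min.
Qed.

End Perfection.
End LengthThree.

(** * Exterior multiplication and contraction *)

Section Clifford.
Variables (R : comNzRingType) (d : nat).
Implicit Types (i j k l : 'I_d) (S T : {set 'I_d}) (x y : extalg R d).
Implicit Types (v w : 'rV[R]_d).

(** The number of transpositions that bring g_i to its place in the product of
    the g_t, t in T. *)
Definition nbelow i T : nat := #|[set t in T | (t < i)%N]|.

Definition lmul i x : extalg R d :=
  [ffun T : {set 'I_d} => if i \in T then (-1) ^+ nbelow i T * x (T :\ i) else 0].

Definition contr i x : extalg R d :=
  [ffun T : {set 'I_d} => if i \in T then 0 else (-1) ^+ nbelow i T * x (i |: T)].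

Lemma nbelowD1 i j T : j \in T -> nbelow i T = ((j < i) + nbelow i (T :\ j))%N.
Proof.
move=> jT; rewrite /nbelow (cardsD1 j) inE jT /=; congr (_ + _)%N.
by apply: eq_card => t; rewrite !inE andbA.
Qed.

Lemma nbelowU1 i j T : j \notin T -> nbelow i (j |: T) = ((j < i) + nbelow i T)%N.
Proof. by move=> jT; rewrite (@nbelowD1 i j) ?setU11 // setU1K. Qed.

Lemma nbelow_D1 i T : nbelow i (T :\ i) = nbelow i T.
Proof.
by apply: eq_card => t; rewrite !inE; case: eqVneq => //= ->; rewrite ltnn andbF.
Qed.

Lemma nbelow_U1 i T : nbelow i (i |: T) = nbelow i T.
Proof.
by apply: eq_card => t; rewrite !inE; case: eqVneq => //= ->; rewrite ltnn andbF.
Qed.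

Fact lmul_linear i : linear (lmul i).
Proof.
move=> a x y; apply/ffunP=> T; rewrite !ffunE; case: ifP => _.
  by rewrite mulrDr /GRing.scale /= mulrCA.
by rewrite /GRing.scale /= mulr0 addr0.
Qed.
HB.instance Definition _ i := GRing.isLinear.Build R (extalg R d) (extalg R d) _
  (lmul i) (lmul_linear i).

Fact contr_linear i : linear (contr i).
Proof.
move=> a x y; apply/ffunP=> T; rewrite !ffunE; case: ifP => _.
  by rewrite /GRing.scale /= mulr0 addr0.
by rewrite mulrDr /GRing.scale /= mulrCA.
Qed.
HB.instance Definition _ i := GRing.isLinear.Build R (extalg R d) (extalg R d) _
  (contr i) (contr_linear i).

Lemma lmul_sq i x : lmul i (lmul i x) = 0.
Proof.
by apply/ffunP=> T; rewrite !ffunE; case: ifP => // _; rewrite setD11 mulr0.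
Qed.

Lemma lmul_anti i j x : lmul i (lmul j x) = - lmul j (lmul i x).
Proof.
have [<-|ij] := eqVneq i j; first by rewrite lmul_sq oppr0.
apply/ffunP=> T; rewrite !ffunE !in_setD1 [j == i]eq_sym ij /=.
have [iT|iT] := boolP (i \in T); last by case: ifP; rewrite ?mulr0 oppr0.
have [jT|jT] := boolP (j \in T); last by rewrite mulr0 oppr0.
rewrite (nbelowD1 i jT) (nbelowD1 j iT) !exprD setDDl setUC -setDDl.
have : val i != val j by []; case: ltngtP => // _ _; rewrite /=; ring.
Qed.

(** The Clifford relation; with [lmul_anti] it yields the identities between
    brackets without any shuffle signs. *)
Lemma contr_lmul i j x :
  contr i (lmul j x) = (i == j)%:R *: x - lmul j (contr i x).
Proof.
apply/ffunP=> T; rewrite !ffunE /GRing.scale /=.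
have [<-|ij] := eqVneq i j.
  rewrite mul1r !inE !eqxx /=; have [iT|iT] := boolP (i \in T).
    by rewrite nbelow_D1 mulrA -expr2 sqrr_sign mul1r setD1K // subrr.
  by rewrite nbelow_U1 mulrA -expr2 sqrr_sign mul1r setU1K // subr0.
rewrite mul0r add0r !inE (negbTE ij) /= eq_sym (negbTE ij) /=.
have [iT|iT] := boolP (i \in T); first by case: ifP; rewrite ?mulr0 oppr0.
have [jT|jT] := boolP (j \in T); last by rewrite mulr0 oppr0.
rewrite (nbelowD1 i jT) (nbelowU1 j iT) !exprD.
have -> : (i |: T) :\ j = i |: (T :\ j).
  by apply/setP=> t; rewrite !inE; case: (t =P i) => // ->; rewrite ij.
have : val i != val j by []; case: ltngtP => // _ _; rewrite /=; ring.
Qed.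

Definition vmul v x : extalg R d := \sum_i v 0 i *: lmul i x.

Fact vmul_linear v : linear (vmul v).
Proof.
move=> a x y; rewrite /vmul scaler_sumr -big_split; apply: eq_bigr => i _.
by rewrite linearP scalerDr !scalerA mulrC.
Qed.
HB.instance Definition _ v := GRing.isLinear.Build R (extalg R d) (extalg R d) _
  (vmul v) (vmul_linear v).

Lemma vmul_delta i x : vmul (delta_mx 0 i) x = lmul i x.
Proof.
rewrite /vmul (bigD1 i) //= mxE !eqxx scale1r big1 ?addr0 // => j /negbTE ji.
by rewrite mxE ji andbF scale0r.
Qed.

Lemma vmulE v x : vmul v x = \sum_i v 0 i *: vmul (delta_mx 0 i) x.
Proof. by apply: eq_bigr => i _; rewrite vmul_delta. Qed.

Lemma vmul_anti v w x : vmul v (vmul w x) = - vmul w (vmul v x).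
Proof.
rewrite {1 3}/vmul -sumrN.
under eq_bigr => i _ do rewrite /vmul linear_sum scaler_sumr.
rewrite exchange_big; apply: eq_bigr => j _ /=.
rewrite /vmul linear_sum scaler_sumr -sumrN; apply: eq_bigr => i _.
by rewrite !linearZ /= lmul_anti !scalerN !scalerA mulrC.
Qed.

Lemma contr_vmul k v x : contr k (vmul v x) = v 0 k *: x - vmul v (contr k x).
Proof.
rewrite /vmul linear_sum /=; under eq_bigr => i _ do
  rewrite linearZ /= contr_lmul scalerBr scalerA.
rewrite sumrB; congr (_ - _).
rewrite (bigD1 k) //= eqxx mulr1 big1 ?addr0 // => i; rewrite eq_sym => /negbTE->.
by rewrite mulr0 scale0r.
Qed.

Lemma contr_top k x : contr k x setT = 0.
Proof. by rewrite ffunE inE. Qed.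

End Clifford.

(** * The exponential of an alternating matrix *)

(** Stated without dividing by two, hence the separate hypothesis on the
    diagonal. *)
Lemma sum_alternating (V : zmodType) n (f : 'I_n -> 'I_n -> V) :
  (forall i, f i i = 0) -> (forall i j, f i j = - f j i) ->
  \sum_i \sum_j f i j = 0.
Proof.
move=> f0 fN.
have sumE : \sum_i \sum_j f i j =
    \sum_(i : 'I_n) \sum_(j : 'I_n | (i < j)%N) f i j
      + \sum_(i : 'I_n) \sum_(j : 'I_n | (j < i)%N) f i j.
  rewrite -big_split; apply: eq_bigr => i _ /=.
  rewrite (bigID (fun j : 'I_n => (i < j)%N)) /=; congr (_ + _).
  rewrite (bigD1 i) /= ?ltnn // f0 add0r; apply: eq_bigl => j.
  by rewrite -leqNgt ltn_neqAle andbC.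
rewrite sumE [X in _ + X](exchange_big_dep xpredT) //= -big_split big1 // => i _.
by rewrite -big_split big1 // => j _ /=; rewrite (fN i j) addNr.
Qed.

Section PfaffianExponential.
Variables (R : comNzRingType) (d : nat).
Implicit Types (i j k l : 'I_d) (T : {set 'I_d}) (x y : extalg R d).
Implicit Types (u v w : 'rV[R]_d).

Lemma vmul_sq v x : vmul v (vmul v x) = 0.
Proof.
rewrite /vmul; under eq_bigr => i _ do rewrite linear_sum scaler_sumr.
apply: sum_alternating => [i|i j].
  by rewrite linearZ /= lmul_sq !scaler0.
by rewrite !linearZ /= lmul_anti !scalerN !scalerA mulrC.
Qed.

Definition alternating_mx (A : 'M[R]_d) : Prop :=
  (forall i, A i i = 0) /\ (forall i j, A i j = - A j i).

Variable A : 'M[R]_d.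

Definition row_on (s : seq 'I_d) k : 'rV[R]_d := \row_l (A k l *+ (l \in s)).

(** The exponential of the bivector is the product of the factors
    1 + g_k /\ (sum of the A k l g_l over the l after k), which needs no
    denominators. *)
Fixpoint pfexp_on (s : seq 'I_d) : extalg R d :=
  if s is k :: s' then pfexp_on s' + lmul k (vmul (row_on s' k) (pfexp_on s'))
  else [ffun T : {set 'I_d} => (T == set0)%:R].

Definition pfexp : extalg R d := pfexp_on (enum 'I_d).

(** Contraction is an antiderivation, so it differentiates the product
    defining the exponential one factor at a time. *)
Lemma contr_pfexp_on (s : seq 'I_d) i : alternating_mx A -> uniq s ->
  contr i (pfexp_on s) = (i \in s)%:R *: vmul (row_on s i) (pfexp_on s).
Proof.
move=> [A0 AN]; elim: s => [_|k s IHs /= /andP[ks us]].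
  rewrite scale0r; apply/ffunP=> T; rewrite !ffunE; case: ifP => // iT.
  by rewrite -cards_eq0 cardsU1 iT mulr0.
rewrite linearD /= contr_lmul contr_vmul IHs // mxE inE.
set E := pfexp_on s in IHs *; set r := row_on s k.
have row_cons : row_on (k :: s) i = row_on s i + A i k *: delta_mx 0 k.
  apply/rowP=> l; rewrite !mxE inE eqxx /=.
  have [->|_] := eqVneq l k; last by rewrite mulr0 addr0.
  by rewrite (negbTE ks) add0r mulr1.
have vmulD v w x : vmul (v + w) x = vmul v x + vmul w x.
  by rewrite /vmul -big_split; apply: eq_bigr => l _; rewrite mxE scalerDl.
have vmulZ a v x : vmul (a *: v) x = a *: vmul v x.
  by rewrite /vmul scaler_sumr; apply: eq_bigr => l _; rewrite mxE scalerA.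
have [ik|ik] := eqVneq i k.
  rewrite row_cons; move: ks; rewrite /r -ik => ks.
  rewrite (negbTE ks) /= !scale0r !scale1r A0 !scale0r [vmul _ 0]linear0.
  rewrite subr0 [lmul _ 0]linear0 subr0 add0r addr0 linearD /=.
  by rewrite -vmul_delta vmul_anti vmul_sq linear0 oppr0 addr0.
rewrite scale0r sub0r /=.
case: (boolP (i \in s)) => is_; last first.
  by rewrite !scale0r [vmul r 0]linear0 subr0 [lmul k 0]linear0 subr0.
rewrite mulr1n !scale1r row_cons vmulD vmulZ vmul_delta !linearD /=.
rewrite lmul_sq scaler0 addr0 linearN linearZ /=.
rewrite -[lmul k (vmul r _)]vmul_delta -[lmul k (vmul r E)]vmul_delta.
rewrite [vmul (row_on s i) (vmul (delta_mx _ _) _)]vmul_anti.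
rewrite [vmul r (vmul (row_on s i) E)]vmul_anti linearN.
rewrite (AN k i).
rewrite [vmul _ (- vmul _ (vmul r E))]linearN /= scaleNr !opprK.
by rewrite [RHS]addrAC addrA.
Qed.

Lemma contr_pfexp i : alternating_mx A -> contr i pfexp = vmul (row i A) pfexp.
Proof.
move=> altA; rewrite /pfexp contr_pfexp_on ?enum_uniq // mem_enum scale1r.
by congr vmul; apply/rowP=> l; rewrite !mxE mem_enum.
Qed.

Lemma pfexp0 : pfexp set0 = 1.
Proof.
rewrite /pfexp; elim: (enum _) => [|k s IHs] /=; rewrite !ffunE ?eqxx //.
by rewrite IHs inE addr0.
Qed.

(** The expansion of a Pfaffian along its first row: contracting by the
    smallest element k of T strips g_k without a sign, and [contr_pfexp]
    computes the contraction. *)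
Lemma pfexp_min k T : alternating_mx A -> k \in T -> {in T, forall t : 'I_d, (k <= t)%N} ->
  pfexp T = \sum_(l in T :\ k)
     (-1) ^+ nbelow l (T :\ k) * A k l * pfexp (T :\ k :\ l).
Proof.
move=> altA kT kmin.
have := congr1 (fun x : extalg R d => x (T :\ k)) (contr_pfexp k altA).
rewrite ffunE setD11 setD1K // /vmul sum_ffunE.
have -> : nbelow k (T :\ k) = 0%N.
  rewrite nbelow_D1; apply/eqP; rewrite cards_eq0; apply/eqP/setP=> t.
  by rewrite !inE; case: (boolP (t \in T)) => // /kmin; rewrite ltnNge => ->.
rewrite mul1r => ->; rewrite [RHS]big_mkcond; apply: eq_bigr => l _.
rewrite !ffunE mxE /GRing.scale /=; case: ifP => _; last by rewrite mulr0.
by rewrite mulrCA mulrA.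
Qed.

End PfaffianExponential.

(** * Pfaffians as coefficients of the exponential *)

Section PfaffianRecursion.
Variable n : nat.

(** The increasing enumeration of the indices other than 0 and j + 1. *)
Definition skip2 (j : 'I_n.+1) (i : 'I_n) : 'I_n.+2 := lift ord0 (lift j i).

Lemma skip2_lt j (i i' : 'I_n) : (skip2 j i < skip2 j i')%N = (i < i')%N.
Proof. by rewrite /skip2 /= /bump; lia. Qed.

(** Prepends the pair {0, j + 1} to a matching of the remaining indices. *)
Definition matching_cons (j : 'I_n.+1) (s : 'S_n) : 'S_n.+2 :=
  lift_perm ord0 ord0 (lift_perm ord0 j s).

Lemma matching_cons0 j s : matching_cons j s ord0 = ord0.
Proof. exact: lift_perm_id. Qed.

Lemma matching_cons1 j s : matching_cons j s (lift ord0 ord0) = lift ord0 j.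
Proof. by rewrite /matching_cons lift_perm_lift lift_perm_id. Qed.

Lemma matching_cons2 j s i :
  matching_cons j s (lift ord0 (lift ord0 i)) = skip2 j (s i).
Proof. by rewrite /matching_cons !lift_perm_lift. Qed.

Lemma matching_cons_inj : injective (fun p => matching_cons p.1 p.2).
Proof.
move=> [j s] [j' s'] /= eqs.
have eqj : j = j'.
  by apply: (@lift_inj _ ord0); rewrite -(matching_cons1 j s) eqs matching_cons1.
congr pair => //; apply/permP=> i; apply: (@lift_inj _ j); apply: (@lift_inj _ ord0).
by rewrite -/(skip2 _ _) -matching_cons2 eqs matching_cons2 eqj.
Qed.

Lemma lift_perm_exists m (s : 'S_m.+1) i0 j0 :
  s i0 = j0 -> exists s', s = lift_perm i0 j0 s'.
Proof.
move=> si0.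
have /choice[f fE] (i : 'I_m) : exists k, s (lift i0 i) = lift j0 k.
  case: (unliftP j0 (s (lift i0 i))) => [k ->|]; first by exists k.
  by rewrite -si0 => /perm_inj/eqP; rewrite eq_sym (negbTE (neq_lift _ _)).
have f_inj : injective f.
  move=> i i' eqf; apply: (@lift_inj _ i0); apply: (@perm_inj _ s).
  by rewrite !fE eqf.
exists (perm f_inj); apply/permP=> i.
case: (unliftP i0 i) => [i' ->|->]; first by rewrite lift_perm_lift fE permE.
by rewrite lift_perm_id.
Qed.

Lemma matching_permP m (s : 'S_m) :
  reflect ((forall i : 'I_m, ~~ odd i -> (s i < s (ordS i))%N) /\
           (forall i j : 'I_m, ~~ odd i -> ~~ odd j -> (i < j)%N -> (s i < s j)%N))
          (matching_perm s).
Proof.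
apply: (iffP andP) => -[H1 H2]; split.
- by move=> i; move/forallP/(_ i)/implyP: H1.
- move=> i j ei ej ij; move/forallP/(_ i)/forallP/(_ j)/implyP: H2.
  by apply; rewrite ei ej.
- by apply/forallP=> i; apply/implyP/H1.
- apply/forallP=> i; apply/forallP=> j; apply/implyP=> /and3P[]; exact: H2.
Qed.

Hypothesis n_even : ~~ odd n.

Lemma even_succ_lt m (i : 'I_m) : ~~ odd m -> ~~ odd i -> (i.+1 < m)%N.
Proof.
move=> em ei; rewrite ltn_neqAle ltn_ord andbT; apply: contraNneq em => <-.
by rewrite /= ei.
Qed.

Lemma ordS_lift2 (i : 'I_n) : ~~ odd i ->
  ordS (lift ord0 (lift ord0 i)) = lift ord0 (lift ord0 (ordS i)).
Proof.
move=> ei; apply: val_inj; have lt_i := even_succ_lt n_even ei.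
by rewrite /= /bump /= !add1n !modn_small.
Qed.

Lemma ordS_ord0 : ordS ord0 = lift ord0 ord0 :> 'I_n.+2.
Proof. exact: val_inj. Qed.

Lemma odd_lift2 (i : 'I_n) : odd (lift ord0 (lift ord0 i)) = odd i.
Proof. by rewrite !lift0 /= negbK. Qed.

Lemma matching_cons_matching j s : matching_perm (matching_cons j s) = matching_perm s.
Proof.
apply/matching_permP/matching_permP => -[H1 H2]; split.
- move=> i ei; have := H1 (lift ord0 (lift ord0 i)).
  rewrite ordS_lift2 // !matching_cons2 skip2_lt; apply.
  by rewrite odd_lift2.
- move=> i i' ei ei' ltii'.
  have := H2 (lift ord0 (lift ord0 i)) (lift ord0 (lift ord0 i')).
  rewrite !matching_cons2 skip2_lt; by apply; rewrite ?odd_lift2 ?lift0.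
- move=> i; case: (unliftP ord0 i) => [i1 ->|->]; last first.
    by rewrite ordS_ord0 matching_cons0 matching_cons1.
  case: (unliftP ord0 i1) => [i2 ->|->] ei2; last by rewrite lift0 in ei2.
  rewrite odd_lift2 in ei2.
  by rewrite ordS_lift2 // !matching_cons2 skip2_lt; apply: H1.
move=> i i'; case: (unliftP ord0 i') => [i1' ->|-> //].
case: (unliftP ord0 i1') => [i2' ->|-> //].
case: (unliftP ord0 i) => [i1 ->|->]; last by rewrite matching_cons0 matching_cons2.
case: (unliftP ord0 i1) => [i2 ->|->]; last by rewrite lift0.
rewrite !matching_cons2 skip2_lt !odd_lift2 !lift0 !ltnS.
exact: H2.
Qed.

(** A matching in normal form starts with 0: an odd position holds the larger
    element of its pair, and among the even positions the values increase. *)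
Lemma matching_cons_surj (s : 'S_n.+2) : matching_perm s ->
  exists p : 'I_n.+1 * 'S_n, s = matching_cons p.1 p.2.
Proof.
case/matching_permP=> H1 H2.
(* The position i of the value 0 must be the first one. *)
have s0 : s ord0 = ord0.
  apply: val_inj; apply/eqP; rewrite -leqn0 leqNgt; apply/negP=> s0_gt0.
  pose i := (s^-1)%g ord0; have si : s i = ord0 by rewrite permKV.
  have [ei|ei] := boolP (odd i).
    have i_gt0 : (0 < i)%N by case: (val i) ei.
    have lt_i1 : (i.-1 < n.+2)%N by apply: leq_ltn_trans (ltn_ord i); apply: leq_pred.
    have := H1 (Ordinal lt_i1); suff -> : ordS (Ordinal lt_i1) = i.
      by rewrite si ltn0 /= -subn1 oddB // ei => /(_ isT).
    by apply: val_inj; rewrite /= prednK // modn_small.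
  have := H2 ord0 i; rewrite si ltn0 => /(_ isT ei) H.
  suff : (0 < i)%N by move/H.
  rewrite lt0n; apply/eqP=> i0; have i_0 : i = ord0 by apply: val_inj.
  by move: s0_gt0; rewrite -i_0 si.
have [s1 s1E] := lift_perm_exists s0.
have [s2 s2E] := lift_perm_exists (erefl (s1 ord0)).
by exists (s1 ord0, s2); rewrite /= /matching_cons -s2E.
Qed.


End PfaffianRecursion.

Section PfaffianMatrix.
Variable R : comNzRingType.

Lemma Pf_odd n (A : 'M[R]_n) : odd n -> Pf A = 0.
Proof. by rewrite /Pf => ->. Qed.

(** The matchings of n + 2 points are sorted by the partner of the first
    point. *)
Lemma Pf_rec n (A : 'M[R]_n.+2) : Pf A =
  \sum_(j < n.+1) (-1) ^+ j * A ord0 (lift ord0 j) * Pf (mxsub (skip2 j) (skip2 j) A).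
Proof.
have [on|en] := boolP (odd n).
  rewrite Pf_odd ?big1 // => [j _|]; last by rewrite /= negbK.
  by rewrite (Pf_odd _ on) mulr0.
rewrite /Pf /= negbK (negbTE en).
transitivity (\sum_(p : 'I_n.+1 * 'S_n | matching_perm p.2)
   (-1) ^+ matching_cons p.1 p.2 *
   \prod_(i < n.+2 | ~~ odd i)
      A (matching_cons p.1 p.2 i) (matching_cons p.1 p.2 (ordS i))).
  have injP : {in [pred p : 'I_n.+1 * 'S_n | matching_perm p.2] &,
      injective (fun p => matching_cons p.1 p.2)}.
    by move=> p q _ _; apply: matching_cons_inj.
  rewrite -(big_imset (fun s : 'S_n.+2 => (-1) ^+ s *
     \prod_(i < n.+2 | ~~ odd i) A (s i) (s (ordS i))) injP) /=.
  apply: eq_bigl => s; apply/idP/imsetP => [ms|[p pm ->]].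
    have [p ps] := matching_cons_surj ms; exists p => //.
    by rewrite inE -(matching_cons_matching en p.1) -ps.
  by rewrite matching_cons_matching.
rewrite -(pair_big_dep xpredT (fun _ (s : 'S_n) => matching_perm s)
  (fun j s => (-1) ^+ matching_cons j s * \prod_(i < n.+2 | ~~ odd i)
      A (matching_cons j s i) (matching_cons j s (ordS i)))) /=.
apply: eq_bigr => j _; rewrite mulr_sumr; apply: eq_bigr => s _.
rewrite /matching_cons !odd_lift_perm /= -/(matching_cons j s).
rewrite signr_addb signr_odd -!mulrA; congr (_ * _).
rewrite mulrCA; congr (_ * _).
rewrite big_mkcond big_ord_recl big_ord_recl -[X in _ = _ * X]mul1r.
apply: (congr2 *%R); first by rewrite /= ordS_ord0 matching_cons0 matching_cons1.
apply: (congr2 *%R); first by [].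
rewrite [RHS]big_mkcond; apply: eq_bigr => i _.
rewrite odd_lift2; case: ifP => // ei.
by rewrite ordS_lift2 // !matching_cons2 mxE.
Qed.

Lemma Pf_0 (A : 'M[R]_0) : Pf A = 1.
Proof.
rewrite /Pf /= (bigD1 1%g) /=; last by apply/matching_permP; split=> -[].
rewrite big_ord0 odd_perm1 mulr1 big1 ?addr0 // => s /andP[_ /eqP[]].
by apply/permP=> -[].
Qed.

Variables (d : nat) (A : 'M[R]_d).
Hypothesis A_alt : alternating_mx A.

(** Both sides satisfy the expansion along the first row. *)
Lemma Pf_mxsub n (f : 'I_n -> 'I_d) : {homo f : i j / (i < j)%N >-> (i < j)%N} ->
  Pf (mxsub f f A) = pfexp A [set f i | i in 'I_n].
Proof.
have [k] := ubnP n; elim: k n f => // k IHk n f; case: n f => [|[|n]] f.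
- move=> _ _; rewrite Pf_0 (_ : [set _ | _ in _] = set0) ?pfexp0 //.
  by apply/setP=> t; rewrite inE; apply/imsetP=> -[[]].
- move=> _ _; rewrite Pf_odd // (@pfexp_min _ _ _ (f ord0)) //.
  + rewrite big1 // => l; rewrite !inE => /andP[+ /imsetP[i _ li]].
    by rewrite li (ord1 i) eqxx.
  + exact: imset_f.
  + by move=> t /imsetP[i _ ->]; rewrite (ord1 i).
rewrite !ltnS => lt_nk f_mono.
have f_inj : injective f.
  move=> i j eqf; apply/eqP; rewrite -val_eqE /=; case: ltngtP => // /f_mono.
    by rewrite eqf ltnn.
  by rewrite eqf ltnn.
have f_le i : (f ord0 <= f i)%N.
  by case: (unliftP ord0 i) => [j ->|-> //]; apply/ltnW/f_mono.
rewrite Pf_rec (@pfexp_min _ _ _ (f ord0)) //; first last.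
- by move=> t /imsetP[i _ ->].
- exact: imset_f.
have imf0 : [set f i | i in 'I_n.+2] :\ f ord0 = [set f (lift ord0 j) | j in 'I_n.+1].
  apply/setP=> t; rewrite !inE; apply/andP/imsetP => [[tn /imsetP[i _ ti]]|[j _ ->]].
    case: (unliftP ord0 i) ti tn => [j -> -> _|-> ->]; first by exists j.
    by rewrite eqxx.
  by rewrite imset_f // (inj_eq f_inj) eq_sym neq_lift.
rewrite imf0 big_imset /=; last by move=> i j _ _ /f_inj/lift_inj.
apply: eq_bigr => j _; congr (_ * _ * _).
- congr (_ ^+ _); rewrite /nbelow.
  have -> : [set t in [set f (lift ord0 j0) | j0 in 'I_n.+1] | (t < f (lift ord0 j))%N]
     = [set f (lift ord0 i) | i in [set i : 'I_n.+1 | (i < j)%N]].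
    apply/setP=> t; rewrite !inE; apply/andP/imsetP => [[/imsetP[i _ ->] lt_fi]|[i]].
      exists i => //; rewrite inE; case: (ltngtP i j) lt_fi => //.
        by move=> lt_ji; rewrite ltnNge ltnW // f_mono // !lift0.
      by move=> /val_inj->; rewrite ltnn.
    rewrite inE => lt_ij ->; split; first exact: imset_f.
    by apply: f_mono; rewrite !lift0.
  rewrite card_imset; last by move=> i i' /f_inj/lift_inj.
  rewrite -sum1dep_card (big_ord_narrow (ltnW (ltn_ord j))).
  by rewrite sum1_card card_ord.
- by rewrite mxE.
rewrite -mxsub_comp IHk ?(ltnW lt_nk) //; last by move=> i i' lt_ii; apply: f_mono; rewrite skip2_lt.
congr (pfexp A _); apply/setP=> t; rewrite !inE.
apply/imsetP/andP => [[i _ ->]|[tn /imsetP[i _ ti]]].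
  rewrite (inj_eq f_inj) /skip2 (inj_eq (@lift_inj _ _)) eq_sym neq_lift; split=> //.
  exact: imset_f.
case: (unliftP j i) ti tn => [i' -> -> _|-> ->]; first by exists i'.
by rewrite eqxx.
Qed.

Lemma subPf_pfexp (T : {set 'I_d}) : subPf A T = pfexp A T.
Proof.
rewrite /subPf Pf_mxsub.
  by congr (pfexp A _); apply/setP=> t; apply/imsetP/idP => [[i _ ->]|tT];
    [apply: enum_valP | exists (enum_rank_in tT t); rewrite ?enum_rankK_in].
move=> i j lt_ij; have t0 : 'I_d := enum_val i.
rewrite !(enum_val_nth t0) -!(nth_map t0 0%N val) -?cardE //.
have srt : sorted ltn [seq val x | x <- enum (mem T)].
  rewrite {1}/enum_mem; apply: (subseq_sorted ltn_trans (map_subseq _ (filter_subseq _ _))).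
  by rewrite -enumT val_enum_ord iota_ltn_sorted.
by rewrite (sorted_ltn_nth ltn_trans) // inE size_map -cardE.
Qed.

End PfaffianMatrix.

(** * Brackets and the complex of length three *)

Section Cyclic3.

(** The cyclic order on the three indices, which makes the cross product
    uniform in the index. *)
Definition nx (k : 'I_3) : 'I_3 := k + 1.

Lemma nx3 k : nx (nx (nx k)) = k.
Proof. by apply: val_inj; case: k => [[|[|[]]]]. Qed.

Lemma nx_neq k : (nx k == k) = false.
Proof. by case: k => [[|[|[]]]]. Qed.

Lemma nx2_neq k : (nx (nx k) == k) = false.
Proof. by case: k => [[|[|[]]]]. Qed.

(** An index is compared with a fixed k by its distance in the cyclic order. *)
Lemma nxP k j : [\/ j = k, j = nx k | j = nx (nx k)].
Proof.
case: k j => [[|[|[|//]]] hk] [[|[|[|//]]] hj];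
  by [apply: Or31; apply: val_inj | apply: Or32; apply: val_inj
     | apply: Or33; apply: val_inj].
Qed.

Lemma sum_nx (V : zmodType) (F : 'I_3 -> V) k :
  \sum_i F i = F k + F (nx k) + F (nx (nx k)).
Proof.
rewrite (bigD1 k) //= (bigD1 (nx k)) ?nx_neq //= (bigD1 (nx (nx k))) /=; last first.
  by rewrite nx2_neq nx_neq.
rewrite big1 ?addr0 ?addrA // => i /andP[/andP[n1 n2] n3].
by have [] := nxP k i => e; [move: n1 | move: n2 | move: n3]; rewrite e eqxx.
Qed.

Lemma nx_inj : injective nx.
Proof. exact: addIr. Qed.

End Cyclic3.

Lemma delta_mulE (R : comNzRingType) m n p (a : 'I_m) (b : 'I_n)
    (M : 'M[R]_(n, p)) i j :
  (delta_mx a b *m M) i j = (i == a)%:R * M b j.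
Proof.
rewrite mxE (bigD1 b) //= mxE eqxx andbT big1 ?addr0 // => k /negbTE kb.
by rewrite mxE kb andbF mul0r.
Qed.

Section Brackets.
Variables (R : comNzRingType) (d : nat) (A : 'M[R]_d).
Hypothesis A_alt : alternating_mx A.
Implicit Types (u v w : 'rV[R]_d) (s : seq 'rV[R]_d).

(** The coefficient of g_1 /\ ... /\ g_d in v_1 /\ ... /\ v_r /\ E. *)
Definition bracket s : R := foldr (@vmul R d) (pfexp A) s setT.

Lemma bracket_sum (s : seq 'rV[R]_d) v :
  bracket (rcons s v) = \sum_l v 0 l * bracket (rcons s (delta_mx 0 l)).
Proof.
rewrite /bracket foldr_rcons vmulE.
have fold_lin (F : 'I_d -> extalg R d) :
    foldr (@vmul R d) (\sum_l v 0 l *: F l) s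
      = \sum_l v 0 l *: foldr (@vmul R d) (F l) s.
  elim: s => //= w s ->; rewrite linear_sum; apply: eq_bigr => l _.
  exact: linearZ.
rewrite fold_lin sum_ffunE; apply: eq_bigr => l _.
by rewrite ffunE foldr_rcons.
Qed.

(** The top coefficient of the contraction of v /\ E is zero. *)
Lemma bracket1 v k : bracket [:: v; row k A] = v 0 k * bracket [::].
Proof.
apply/eqP; rewrite eq_sym -subr_eq0; apply/eqP; rewrite -(contr_top k (vmul v (pfexp A))).
by rewrite contr_vmul contr_pfexp // !ffunE.
Qed.

(** The top coefficient of the contraction of u /\ v /\ w /\ E is zero. *)
Lemma bracket3 u v w k : bracket [:: u; v; w; row k A] =
  u 0 k * bracket [:: v; w] - v 0 k * bracket [:: u; w] + w 0 k * bracket [:: u; v].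
Proof.
apply/eqP; rewrite -subr_eq0; apply/eqP.
have := contr_top k (vmul u (vmul v (vmul w (pfexp A)))).
rewrite !contr_vmul contr_pfexp // !linearB /= !linearZ /= !ffunE.
by rewrite /bracket /= /GRing.scale /= => E; rewrite -[LHS]opprK -[RHS]oppr0 -E; ring.
Qed.

Lemma bracket_swap (s t : seq 'rV[R]_d) u v :
  bracket (s ++ [:: u, v & t]) = - bracket (s ++ [:: v, u & t]).
Proof.
rewrite /bracket !foldr_cat /= vmul_anti.
have fold_opp (x : extalg R d) :
    foldr (@vmul R d) (- x) s = - foldr (@vmul R d) x s.
  by elim: s => //= w s ->; rewrite linearN.
by rewrite fold_opp ffunE.
Qed.

Lemma bracket_dup (s t : seq 'rV[R]_d) u : bracket (s ++ [:: u, u & t]) = 0.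
Proof.
rewrite /bracket !foldr_cat /= vmul_sq.
have -> : foldr (@vmul R d) 0 s = 0 by elim: s => //= w s ->; rewrite linear0.
by rewrite ffunE.
Qed.

Definition wvec u : 'rV[R]_d := \row_l bracket [:: u; delta_mx 0 l].
Definition zvec u v w : 'rV[R]_d := \row_l bracket [:: u; v; w; delta_mx 0 l].
(** The Pfaffian adjoint: up to sign, entry (i, l) is the Pfaffian of A
    without the rows and columns i and l. *)
Definition pfadj : 'M[R]_d := \matrix_(i, l) bracket [:: delta_mx 0 i; delta_mx 0 l].
(** These brackets occur in the homotopy for the generator [u v]. *)
Definition hmat u v : 'M[R]_d :=
  \matrix_(i, l) bracket [:: u; v; delta_mx 0 i; delta_mx 0 l].

Lemma wvec_mul u v : (wvec u *m v^T) 0 0 = bracket [:: u; v].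
Proof.
rewrite (bracket_sum [:: u]) mxE; apply: eq_bigr => l _.
by rewrite !mxE mulrC.
Qed.

Lemma zvec_mul u v w x : (zvec u v w *m x^T) 0 0 = bracket [:: u; v; w; x].
Proof.
rewrite (bracket_sum [:: u; v; w]) mxE; apply: eq_bigr => l _.
by rewrite !mxE mulrC.
Qed.

Lemma hmat_mul u v w i : (hmat u v *m w^T) i 0 = bracket [:: u; v; delta_mx 0 i; w].
Proof.
rewrite (bracket_sum [:: u; v; delta_mx 0 i]) mxE; apply: eq_bigr => l _.
by rewrite !mxE mulrC.
Qed.

Lemma mul_trE m (M : 'M[R]_(m, d)) i k : (M *m A^T) i k = (row i M *m (row k A)^T) 0 0.
Proof. by rewrite !mxE; apply: eq_bigr => l _; rewrite !mxE. Qed.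

Lemma wvec_tr u : wvec u *m A^T = bracket [::] *: u.
Proof.
apply/rowP=> k; rewrite mul_trE row_id wvec_mul bracket1 mxE mulrC //.
Qed.

Lemma zvec_tr u v w : zvec u v w *m A^T =
  bracket [:: v; w] *: u - bracket [:: u; w] *: v + bracket [:: u; v] *: w.
Proof.
by apply/rowP=> k; rewrite mul_trE row_id zvec_mul bracket3 !mxE; ring.
Qed.

Lemma pfadj_row i : row i pfadj = wvec (delta_mx 0 i).
Proof. by apply/rowP=> l; rewrite !mxE. Qed.

Lemma pfadj_tr : pfadj *m A^T = (bracket [::])%:M.
Proof.
apply/row_matrixP=> i; rewrite row_mul pfadj_row wvec_tr.
by rewrite -scalemx1 linearZ /= row1.
Qed.

Lemma tr_pfadj : pfadj^T = - pfadj.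
Proof. by apply/matrixP=> i j; rewrite !mxE (bracket_swap [::] [::]). Qed.

Lemma tr_hmat u v : (hmat u v)^T = - hmat u v.
Proof. by apply/matrixP=> i j; rewrite !mxE (bracket_swap [:: u; v] [::]). Qed.

Lemma trA : A^T = - A.
Proof. by apply/matrixP=> i j; rewrite !mxE A_alt.2. Qed.

Lemma wvec_pfadj u : wvec u = u *m pfadj.
Proof.
apply/rowP=> l; rewrite !mxE (bracket_swap [::] [::]) (bracket_sum [:: _]) -sumrN.
by apply: eq_bigr => i _; rewrite mxE (bracket_swap [::] [::]) mulrN opprK.
Qed.

Lemma hmat_tr u v : hmat u v *m A^T =
  (wvec v)^T *m u - (wvec u)^T *m v + (bracket [:: u; v])%:M.
Proof.
apply/matrixP=> i k; rewrite mul_trE.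
have -> : (row i (hmat u v) *m (row k A)^T) 0 0 = (hmat u v *m (row k A)^T) i 0.
  by rewrite !mxE; apply: eq_bigr => l _; rewrite !mxE.
rewrite hmat_mul bracket3 !mxE !big_ord1 !mxE eqxx /= -mulr_natr [in RHS]eq_sym; ring.
Qed.

Variable U : 'M[R]_(3, d).
Local Notation u k := (row k U).

Definition pf_top : R := bracket [::].
Definition pairing : 'M[R]_3 := \matrix_(k, l) bracket [:: u k; u l].
(** Entry k is [u_(k+1) u_(k+2)], so that x is the vector of the cross
    product encoded by the alternating matrix [pairing]. *)
Definition xvec : 'rV[R]_3 := \row_k pairing (nx k) (nx (nx k)).
Definition wmat : 'M[R]_(3, d) := \matrix_k wvec (u k).
Definition zrow : 'rV[R]_d := zvec (u ord0) (u (nx ord0)) (u (nx (nx ord0))).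

Definition diff1 : 'M[R]_(1 + 3, 1) := col_mx pf_top%:M xvec^T.
(** The upper rows are the relations p z_i = x . w_i of [zrow_pf]; the lower
    ones are the Koszul relations between p and the entries of x. *)
Definition diff2 : 'M[R]_(d + 3, 1 + 3) :=
  block_mx zrow^T (- wmat^T) xvec^T (- pf_top%:M).
Definition diff3 : 'M[R]_(d, d + 3) := row_mx A (- U^T).

Lemma pairingN k l : pairing k l = - pairing l k.
Proof. by rewrite !mxE (bracket_swap [::] [::]). Qed.

Lemma pairing0 k : pairing k k = 0.
Proof. by rewrite mxE (bracket_dup [::] [::]). Qed.

Lemma wmatU : wmat *m U^T = pairing.
Proof.
apply/matrixP=> k l; rewrite [RHS]mxE -wvec_mul !mxE; apply: eq_bigr => i _.
by rewrite !mxE.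
Qed.

Lemma wmatA : wmat *m A^T = pf_top *: U.
Proof. by apply/row_matrixP=> k; rewrite row_mul rowK wvec_tr linearZ. Qed.

Lemma wmat_pfadj : wmat = U *m pfadj.
Proof. by apply/row_matrixP=> k; rewrite row_mul rowK wvec_pfadj. Qed.

Lemma zrowA : zrow *m A^T = xvec *m U.
Proof.
rewrite zvec_tr [RHS]mulmx_sum_row (sum_nx _ ord0) !mxE !nx3.
rewrite [bracket [:: u (nx (nx ord0)); _]](bracket_swap [::] [::]) scaleNr.
by rewrite (_ : nx (nx ord0) = ord_max) //; apply: val_inj.
Qed.

Lemma zrow_nx k : zrow = zvec (u k) (u (nx k)) (u (nx (nx k))).
Proof.
have rot a b c : zvec a b c = zvec b c a.
  apply/rowP=> l; rewrite !mxE (bracket_swap [::]) (bracket_swap [:: b]) opprK //.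
rewrite /zrow; have [] := nxP ord0 k => -> //; first by rewrite rot nx3.
by rewrite rot rot !nx3.
Qed.

Lemma zrowU k : zrow *m (u k)^T = 0.
Proof.
apply/matrixP=> i j; rewrite !ord1 (zrow_nx k) zvec_mul mxE.
rewrite (bracket_swap [:: _; _] [::]) (bracket_swap [:: _] [:: _]) opprK.
exact: (bracket_dup [::]).
Qed.

(** Both sides agree after multiplication by A^T, and the Pfaffian adjoint
    inverts A^T up to p without dividing. *)
Lemma zrow_pf : pf_top *: zrow = xvec *m wmat.
Proof.
rewrite wmat_pfadj mulmxA -zrowA -mulmxA.
have -> : A^T *m pfadj = pf_top%:M.
  by rewrite -[A^T *m _]trmxK trmx_mul tr_pfadj trmxK mulNmx -mulmxN -trA pfadj_tr tr_scalar_mx.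
by rewrite mul_mx_scalar.
Qed.

Lemma diff21 : diff2 *m diff1 = 0.
Proof.
rewrite mul_block_col !mulNmx -trmx_mul -zrow_pf mul_mx_scalar mul_scalar_mx.
by rewrite mul_mx_scalar linearZ /= !subrr col_mx0.
Qed.

Lemma diff32 : diff3 *m diff2 = 0.
Proof.
rewrite mul_row_block !mulNmx !mulmxN opprK -trmx_mul -zrowA trmx_mul trmxK subrr.
rewrite mul_mx_scalar -{1}[A]trmxK -trmx_mul wmatA linearZ /= addNr.
by rewrite row_mx0.
Qed.

Lemma contracts_pf : contracts diff3 diff2 diff1 pf_top.
Proof.
exists (col_mx (- pfadj) 0), (block_mx 0 0 0 (- 1%:M)), (row_mx 1%:M 0).
rewrite /diff1 /diff2 /diff3; split.
- rewrite mul_row_col mulmx0 addr0 mulmxN -mulNmx -trA.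
  by rewrite -[LHS]trmxK trmx_mul tr_pfadj trmxK mulNmx -mulmxN -trA pfadj_tr tr_scalar_mx.
- rewrite mulmx_block mul_col_row !mulmx0 !add0r !mulNmx !mulmxN !mulmx1 !mul0mx !opprK.
  rewrite add_block_mx !add0r !oppr0 !addr0 -mulmxN -trA pfadj_tr.
  have -> : pfadj *m U^T = - wmat^T.
    by rewrite wmat_pfadj trmx_mul tr_pfadj mulNmx opprK.
  by rewrite subrr -scalar_mx_block.
- rewrite mul_col_row mulmx_block !mulmx1 !mulmx0 !mul0mx !add0r mulNmx mul1mx.
  by rewrite mulmxN mulNmx mul1mx opprK add_block_mx !addr0 addrN !add0r -scalar_mx_block.
by rewrite mul_row_col mul1mx mul0mx addr0.
Qed.

(** With xi the k-th unit vector and N the matrix of the cross product with xi,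
    the homotopies are (0 | xi), the block matrix with blocks 0, xi, -NU, 0,
    and the column with blocks h and NW, where h is up to sign the alternating
    matrix of the brackets [u_(k+1) u_(k+2) g_i g_j]. *)
Lemma contracts_xvec m : contracts diff3 diff2 diff1 (xvec 0 m).
Proof.
set f := xvec 0 m.
pose xi : 'rV[R]_3 := delta_mx 0 m.
pose N : 'M[R]_3 := delta_mx (nx m) (nx (nx m)) - delta_mx (nx (nx m)) (nx m).
pose h := - hmat (u (nx m)) (u (nx (nx m))).
have xiX : xi *m xvec^T = f%:M.
  by apply/matrixP=> i j; rewrite !ord1 -rowE mxE [RHS]mxE eqxx mulr1n mxE.
(* The expansion of the double cross product. *)
have NP : - (N *m pairing) = f%:M - xvec^T *m xi.
  apply/matrixP=> i j; rewrite mulmxBl [LHS]mxE [in LHS]mxE [X in _ + X]mxE.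
  rewrite !delta_mulE [RHS]mxE [X in _ = X + _]mxE [X in _ = _ + X]mxE.
  rewrite [X in _ = _ - X]mxE big_ord1 [xi _ _]mxE [xvec^T _ _]mxE eqxx /= /f.
  rewrite [xvec 0 m]mxE [xvec 0 i]mxE.
  have [->|->|->] := nxP m i; have [->|->|->] := nxP m j;
    rewrite ?nx3 ?eqxx ?(inj_eq nx_inj) ?[m == nx _]eq_sym ?nx_neq ?nx2_neq
      ?[m == nx (nx _)]eq_sym ?nx_neq ?nx2_neq ?pairing0
      ?[nx m == _]eq_sym ?nx_neq ?nx2_neq;
    rewrite ?(mulr1n, mulr0n); by [ring | rewrite (pairingN (nx m)); ring].
have NU : N *m U = delta_mx (nx m) 0 *m u (nx (nx m)) - delta_mx (nx (nx m)) 0 *m u (nx m).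
  by rewrite mulmxBl; congr (_ - _); apply/matrixP=> i j; rewrite !delta_mulE mxE.
have WNU : wmat^T *m (N *m U) = (wvec (u (nx m)))^T *m u (nx (nx m))
    - (wvec (u (nx (nx m))))^T *m u (nx m).
  by rewrite NU mulmxBr !mulmxA -!colE -!tr_row !rowK.
have hA : h *m A = f%:M - wmat^T *m (N *m U).
  rewrite mulNmx -mulmxN -trA hmat_tr WNU opprB addrC /f !mxE //.
(* Only the column m survives: the other two repeat a vector. *)
have hU : h *m U^T = zrow^T *m xi.
  apply/matrixP=> j k; rewrite mulNmx mxE.
  have -> : (hmat (u (nx m)) (u (nx (nx m))) *m U^T) j k
     = bracket [:: u (nx m); u (nx (nx m)); delta_mx 0 j; u k].
    by rewrite -hmat_mul !mxE; apply: eq_bigr => l _; rewrite !mxE.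
  rewrite mxE big_ord1 [zrow^T _ _]mxE [xi _ _]mxE (zrow_nx (nx m)) nx3 mxE eqxx /=.
  have [->|->|->] := nxP m k; rewrite ?eqxx ?nx_neq ?nx2_neq ?(mulr1, mulr0).
  - by rewrite (bracket_swap [:: _; _] [::]) opprK.
  - rewrite (bracket_swap [:: _; _] [::]) (bracket_swap [:: _] [:: _]).
    by rewrite (bracket_dup [::] [:: _; _]) !oppr0.
  - rewrite (bracket_swap [:: _; _] [::]).
    by rewrite (bracket_dup [:: _] [:: _]) !oppr0.
have trN : N^T = - N by rewrite raddfB /= !trmx_delta opprB.
have trh : h^T = - h by rewrite /h raddfN /= tr_hmat.
have trP : pairing^T = - pairing.
  by apply/matrixP=> i j; rewrite mxE [RHS]mxE pairingN.
exists (col_mx h (N *m wmat)), (block_mx 0 xi (- (N *m U)) 0), (row_mx 0 xi).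
rewrite /diff1 /diff2 /diff3; split.
- rewrite mul_row_col mulNmx.
  have := congr1 trmx hA; rewrite trmx_mul [A^T]trA trh mulNmx mulmxN opprK => ->.
  by rewrite raddfB /= tr_scalar_mx !trmx_mul trmxK trN mulmxN mulNmx opprK mulmxA addrK.
- rewrite mulmx_block mul_col_row !mulmx0 !add0r !addr0 add_block_mx.
  rewrite mulNmx mulmxN opprK hA addrC subrK.
  rewrite mulNmx mulmxN opprK -(mulmxA N wmat A).
  have -> : wmat *m A = - (pf_top *: U) by rewrite -[A]opprK -trA mulmxN wmatA.
  have -> : hmat (u (nx m)) (u (nx (nx m))) *m U^T = - (zrow^T *m xi).
    by rewrite -hU mulNmx opprK.
  rewrite !mulmxN !mulNmx opprK mul_scalar_mx -scalemxAr !addrN.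
  by rewrite -mulmxA wmatU NP addrC subrK -scalar_mx_block.
- rewrite mul_col_row mulmx_block !mulmx0 !mul0mx !add0r !addr0 add_block_mx !add0r.
  rewrite xiX mul_scalar_mx mulmxN mul_mx_scalar addrN.
  have -> : - (N *m U) *m zrow^T = 0.
    rewrite mulNmx -mulmxA (_ : U *m zrow^T = 0) ?mulmx0 ?oppr0 //.
    apply/row_matrixP=> k; rewrite row_mul row0 -[LHS]trmxK trmx_mul trmxK zrowU.
    by rewrite trmx0.
  rewrite mulNmx mulmxN opprK -mulmxA -[U *m _]trmxK trmx_mul trmxK wmatU trP.
  by rewrite mulmxN NP addrC subrK -scalar_mx_block.
by rewrite mul_row_col mul0mx add0r xiX.
Qed.

End Brackets.

(** * Wedge products with vectors *)

Section WedgeVectors.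
Variables (R : comNzRingType) (d : nat).
Implicit Types (v w : 'rV[R]_d) (x y : extalg R d) (T : {set 'I_d}).

Definition ext_vec v : extalg R d := \sum_i v 0 i *: ext_gen R i.

Lemma ninv_set1 i T : i \in T -> ((ninv (T :\ i) [set i] + nbelow i T)%N = #|T|.-1).
Proof.
move=> iT; rewrite (cardsD1 i T) iT add1n /= -nbelow_D1.
rewrite -(cardsID [set t : 'I_d | (t < i)%N] (T :\ i)) addnC; congr (_ + _)%N.
  by rewrite /nbelow; apply: eq_card => t; rewrite !inE.
transitivity #|[set (t, i) | t in T :\ i :\: [set t : 'I_d | (t < i)%N]]|; last first.
  by rewrite card_imset // => t t' [].
rewrite /ninv; apply: eq_card => -[s t]; rewrite !inE /=.
apply/andP/imsetP => [[/andP[/andP[si sT] /eqP->] lt_is]|[s' + [-> ->]]].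
  by exists s => //; rewrite !inE -leqNgt ltnW // si sT.
rewrite !inE eqxx andbT -leqNgt => /and3P[le_is si sT]; rewrite si sT; split=> //.
by rewrite ltn_neqAle le_is andbT eq_sym -val_eqE in si *.
Qed.

(** Multiplying by a vector on the right differs from multiplying on the left
    by the sign of moving it past the other factors. *)
Lemma wedge_vec x v T :
  wedge x (ext_vec v) T = (-1) ^+ #|T|.-1 * vmul v x T.
Proof.
rewrite ffunE /vmul [in RHS]sum_ffunE mulr_sumr.
transitivity (\sum_(U : {set 'I_d} | U \subset T) \sum_i
   (-1) ^+ ninv U (T :\: U) * x U * (v 0 i * (T :\: U == [set i])%:R)).
  apply: eq_bigr => U _; rewrite /ext_vec sum_ffunE mulr_sumr.
  by apply: eq_bigr => i _; rewrite !ffunE.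
rewrite exchange_big /=; apply: eq_bigr => i _; rewrite !ffunE /GRing.scale /=.
case: ifPn => [iT|iT]; last first.
  rewrite !mulr0 big1 // => U _; case: eqP => [TU|_]; last by rewrite !mulr0.
  by have := set11 i; rewrite -TU inE (negbTE iT) andbF.
have DTi : T :\: (T :\ i) = [set i].
  by rewrite setDDr setDv set0U; apply/setIidPr; rewrite sub1set.
rewrite (bigD1 (T :\ i)) ?subD1set //= big1 => [|U /andP[UT Ui]]; last first.
  case: eqP => [TU|_]; last by rewrite !mulr0.
  case/eqP: Ui; rewrite -TU setDDr setDv set0U; exact/esym/setIidPr.
rewrite addr0 DTi eqxx mulr1 -(ninv_set1 iT) exprD.
have signK (a b c e : R) : a * a = 1 -> b * c * e = b * a * (e * (a * c)).
  by move=> aa; rewrite -[LHS]mulr1 -aa; ring.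
by apply: signK; rewrite -expr2 sqrr_sign.
Qed.

(** Lets the exponential replace a single divided power, since only the
    coefficients of one degree enter. *)
Lemma vmul_local v x y T : {in T, forall i, x (T :\ i) = y (T :\ i)} ->
  vmul v x T = vmul v y T.
Proof.
move=> xy; rewrite /vmul !sum_ffunE; apply: eq_bigr => i _.
by rewrite !ffunE; case: ifP => // /xy->.
Qed.

Lemma ext_top_divpow (A : 'M[R]_d) m : alternating_mx A -> d = (2 * m)%N ->
  ext_top (ext_divpow A m) = bracket A [::].
Proof.
by move=> altA dE; rewrite /ext_top ffunE cardsT card_ord ifT ?subPf_pfexp //; apply/eqP.
Qed.

(** Two vectors commute with elements of even degree up to the sign of
    exchanging them, and the two multiplications on the right give that sign
    back. *)
Lemma ext_top_divpow2 (A : 'M[R]_d) m v w : alternating_mx A -> d = (2 * m.+1)%N ->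
  ext_top (wedge (wedge (ext_divpow A m) (ext_vec v)) (ext_vec w))
  = bracket A [:: v; w].
Proof.
move=> altA dE; rewrite /ext_top wedge_vec cardsT card_ord.
have -> : (-1) ^+ d.-1 = -1 :> R.
  by rewrite -signr_odd [X in X.-1]dE mul2n /= odd_double.
rewrite mulN1r /bracket /= vmul_anti ffunE; congr (- _).
apply: vmul_local => i _; have ci := cardsD1 i setT.
have {}ci : #|[set: 'I_d] :\ i| = (2 * m).+1.
  by move: ci; rewrite cardsT card_ord inE; lia.
rewrite wedge_vec ci mulnC exprM sqrr_sign mul1r.
apply: vmul_local => j jT; rewrite ffunE subPf_pfexp // ifT //.
by have := cardsD1 j ([set: 'I_d] :\ i); rewrite ci jT; lia.
Qed.

End WedgeVectors.

(** * Regularity tested on leading forms *)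

Section LeadingForms.
Variables (R : idomainType) (Phi : {rmorphism R -> {poly R}}).
Hypothesis Phi_homog : forall x k, Phi (Phi x)`_k = (Phi x)`_k *: 'X^k.
Hypothesis Phi_eval1 : forall x, (Phi x).[1] = x.
Implicit Types (a b c e f x : R) (k : nat).

Local Notation cf k x := (Phi x)`_k.
Local Notation sz x := (size (Phi x%R)).

(** A grading of R by the natural numbers is given as a coaction Phi: the
    component of degree k of x is the coefficient of degree k of Phi x. *)
Definition top_form x : R := lead_coef (Phi x).
Definition fdeg x : nat := (size (Phi x)).-1.
(** The component of e that contributes to degree k in a product with an
    element of degree n. *)
Definition hcomp e k n : R := if (k < n)%N then 0 else cf (k - n) e.

Lemma Phi_eq0 x : (Phi x == 0) = (x == 0).
Proof.
apply/eqP/eqP=> [x0|->]; last exact: rmorph0.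
by rewrite -(Phi_eval1 x) x0 horner0.
Qed.

Lemma top_form_eq0 x : (top_form x == 0) = (x == 0).
Proof. by rewrite lead_coef_eq0 Phi_eq0. Qed.

Lemma size_Phi x : x != 0 -> size (Phi x) = (fdeg x).+1.
Proof. by rewrite -Phi_eq0 => nz; rewrite prednK // size_poly_gt0. Qed.

Lemma size_PhiM x y : x != 0 -> y != 0 -> size (Phi (x * y)) = (fdeg x + fdeg y).+1.
Proof.
move=> x0 y0; rewrite rmorphM size_mul ?Phi_eq0 // !size_Phi //.
by rewrite addSn addnS.
Qed.

Lemma fdegM x y : x != 0 -> y != 0 -> fdeg (x * y) = (fdeg x + fdeg y)%N.
Proof. by move=> x0 y0; rewrite {1}/fdeg size_PhiM. Qed.

Lemma top_formM x y : top_form (x * y) = top_form x * top_form y.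
Proof. by rewrite /top_form rmorphM lead_coefM. Qed.

Lemma cf_homog y k : Phi y = y *: 'X^k -> cf k y = y.
Proof. by move->; rewrite coefZ coefXn eqxx mulr1. Qed.

Lemma top_form_homog x : Phi (top_form x) = top_form x *: 'X^(fdeg x).
Proof. exact: Phi_homog. Qed.

Lemma hcomp_homog e k n : (n <= k)%N -> Phi (hcomp e k n) = hcomp e k n *: 'X^(k - n).
Proof. by move=> le_nk; rewrite /hcomp ltnNge le_nk; apply: Phi_homog. Qed.

Lemma cf_mul_top e f k : cf k (e * top_form f) = hcomp e k (fdeg f) * top_form f.
Proof.
rewrite rmorphM top_form_homog -scalerAr coefZ coefMXn /hcomp.
by case: ifP => _; rewrite ?mulr0 ?mul0r // mulrC.
Qed.

Lemma cf_mul e f k : (sz (e * f) <= k.+1)%N ->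
  cf k (e * f) = hcomp e k (fdeg f) * top_form f.
Proof.
have [->|e0] := eqVneq e 0.
  by rewrite mul0r rmorph0 coef0 /hcomp rmorph0 coef0 if_same mul0r.
have [->|f0] := eqVneq f 0.
  by rewrite mulr0 rmorph0 coef0 /top_form rmorph0 lead_coef0 mulr0.
rewrite size_PhiM // ltnS leq_eqVlt => /orP[/eqP<-|lt_k].
  by rewrite /hcomp ltnNge leq_addl /= addnK -top_formM -fdegM.
rewrite nth_default; last by rewrite size_PhiM.
rewrite /hcomp; case: ltnP => [|le_fk]; first by rewrite mul0r.
by rewrite nth_default ?mul0r // size_Phi // ltn_subRL addnC.
Qed.

Lemma size_hcomp_mul e f k : (sz (hcomp e k (fdeg f) * f) <= k.+1)%N.
Proof.
have [->|h0] := eqVneq (hcomp e k (fdeg f)) 0.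
  by rewrite mul0r rmorph0 size_poly0.
have le_fk : (fdeg f <= k)%N.
  by rewrite leqNgt; apply: contraNN h0; rewrite /hcomp => ->.
have [->|f0] := eqVneq f 0; first by rewrite mulr0 rmorph0 size_poly0.
rewrite size_PhiM // ltnS {1}/fdeg hcomp_homog // size_scale // size_polyXn /=.
by rewrite subnK.
Qed.

Lemma cf_hcomp_mul e f k :
  cf k (hcomp e k (fdeg f) * f) = hcomp e k (fdeg f) * top_form f.
Proof.
rewrite cf_mul ?size_hcomp_mul //; case: (ltnP k (fdeg f)) => [lt|le].
  by rewrite /hcomp lt.
by congr (_ * _); rewrite {1}/hcomp ltnNge le /= cf_homog // hcomp_homog.
Qed.

Lemma size_drop x k : (size (Phi x) <= k.+1)%N -> cf k x = 0 -> (size (Phi x) <= k)%N.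
Proof.
move=> le_xk xk0; apply/leq_sizeP => j; rewrite leq_eqVlt => /orP[/eqP<- //|lt_kj].
by rewrite nth_default // (leq_trans le_xk).
Qed.

Lemma size_PhiD x y k : (size (Phi x) <= k)%N -> (size (Phi y) <= k)%N ->
  (sz (x + y) <= k)%N.
Proof.
by move=> sx sy; rewrite rmorphD (leq_trans (size_polyD _ _)) // geq_max sx sy.
Qed.

Lemma size_PhiB x y k : (size (Phi x) <= k)%N -> (size (Phi y) <= k)%N ->
  (sz (x - y) <= k)%N.
Proof. by move=> sx sy; apply: size_PhiD; rewrite // rmorphN size_polyN. Qed.

Variables f1 f2 f3 : R.
Hypotheses (f1_neq0 : f1 != 0) (f2_neq0 : f2 != 0) (f3_neq0 : f3 != 0).
Local Notation g1 := (top_form f1).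
Local Notation g2 := (top_form f2).
Local Notation g3 := (top_form f3).
Hypothesis top_reg2 :
  forall c, (exists b, c * g2 = b * g1) -> exists b, c = b * g1.
Hypothesis top_reg3 :
  forall a, (exists b c, a * g3 = b * g1 + c * g2) ->
  exists b c, a = b * g1 + c * g2.

(** If f1 divides c f2, the leading form of c is divisible by that of f1, and
    subtracting the corresponding multiple of f1 lowers the degree of c. *)
Lemma regular2_of_top c :
  (exists b, c * f2 = b * f1) -> exists b, c = b * f1.
Proof.
have [n] := ubnP (size (Phi c)); elim: n c => // n IHn c lt_cn [b cb].
have [->|c0] := eqVneq c 0; first by exists 0; rewrite mul0r.
have [|e ce] := top_reg2 (c := top_form c).
  by exists (top_form b); rewrite -!top_formM cb.
set h := hcomp e (fdeg c) (fdeg f1).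
have {}ce : top_form c = h * g1.
  by rewrite -[LHS](cf_homog (top_form_homog c)) ce cf_mul_top.
have [||b' b'E] := IHn (c - h * f1).
- apply: (@leq_trans (size (Phi c))) => //; rewrite (size_Phi c0) ltnS.
  apply: size_drop.
    by apply: size_PhiB; [rewrite size_Phi | apply: size_hcomp_mul].
  by rewrite rmorphB coefB cf_hcomp_mul -ce subrr.
- by exists (b - h * f2); rewrite !mulrBl cb; ring.
by exists (b' + h); rewrite mulrDl -b'E subrK.
Qed.

(** An element of (f1, f2) needs no cancellation of higher terms: when the top
    terms of b f1 and c f2 cancel, regularity of the leading forms makes this
    cancellation a multiple of the Koszul relation between f1 and f2, which
    can be subtracted. *)
Lemma bounded_combination h b c N : h = b * f1 + c * f2 ->
    (size (Phi h) <= N)%N ->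
  exists b' c', [/\ h = b' * f1 + c' * f2,
    (sz (b' * f1) <= N)%N & (sz (c' * f2) <= N)%N].
Proof.
move=> hE le_hN.
have [M] : exists M, (sz (b * f1) <= N + M)%N /\ (sz (c * f2) <= N + M)%N.
  exists (sz (b * f1) + sz (c * f2))%N.
  by split; rewrite addnA ?leq_addl // addnAC leq_addl.
elim: M b c hE => [|M IHM] b c hE [le_b le_c].
  by exists b, c; rewrite addn0 in le_b le_c.
set k := (N + M)%N; rewrite addnS -/k in le_b le_c.
have hk : cf k h = 0 by rewrite nth_default // (leq_trans le_hN) // leq_addr.
set B := hcomp b k (fdeg f1); set C := hcomp c k (fdeg f2).
have BC : B * g1 + C * g2 = 0 by rewrite -!cf_mul // -coefD -rmorphD -hE.
have [|e Ce] := top_reg2 (c := C).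
  by exists (- B); apply/eqP; rewrite mulNr -addr_eq0 addrC BC.
set e' := hcomp e k (fdeg (f1 * f2)).
have {}Ce : C = e' * g1.
  rewrite /e' fdegM //; have [lt_k|le_k] := ltnP k (fdeg f2).
    by rewrite /C /hcomp lt_k (leq_trans lt_k) ?mul0r // leq_addl.
  have -> : hcomp e k (fdeg f1 + fdeg f2) = hcomp e (k - fdeg f2) (fdeg f1).
    by rewrite /hcomp ltn_subLR // addnC subnDA.
  rewrite -cf_mul_top -Ce cf_homog //; exact: hcomp_homog.
have Be : B = - (e' * g2).
  apply: (mulIf (x := g1)); first by rewrite top_form_eq0.
  by apply/eqP; rewrite mulNr -addr_eq0 -BC Ce; apply/eqP; ring.
have e'k : cf k (e' * (f1 * f2)) = e' * (g1 * g2) by rewrite cf_hcomp_mul top_formM.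
have se' := size_hcomp_mul e (f1 * f2) k.
apply: (IHM (b + e' * f2) (c - e' * f1)); first by rewrite hE; ring.
rewrite -/k; split; apply: size_drop.
- by rewrite (_ : _ * _ = b * f1 + e' * (f1 * f2)); [apply: size_PhiD | ring].
- rewrite (_ : _ * f1 = b * f1 + e' * (f1 * f2)); last by ring.
  by rewrite rmorphD coefD e'k cf_mul // -/B Be; ring.
- by rewrite (_ : _ * _ = c * f2 - e' * (f1 * f2)); [apply: size_PhiB | ring].
rewrite (_ : _ * f2 = c * f2 - e' * (f1 * f2)); last by ring.
by rewrite rmorphB coefB e'k cf_mul // -/C Ce; ring.
Qed.

(** By [bounded_combination] the leading form of a f3 lies in the ideal of the
    leading forms of f1 and f2; hence so does that of a, and its removal
    lowers the degree of a. *)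
Lemma regular3_of_top a : (exists b c, a * f3 = b * f1 + c * f2) ->
  exists b c, a = b * f1 + c * f2.
Proof.
have [n] := ubnP (size (Phi a)); elim: n a => // n IHn a lt_an [b [c abc]].
have [->|a0] := eqVneq a 0; first by exists 0, 0; rewrite !mul0r addr0.
have [b1 [c1 [{}abc le_b le_c]]] := bounded_combination abc (leqnn _).
rewrite (size_PhiM a0 f3_neq0) in le_b le_c.
have [|e1 [e2 ae]] := top_reg3 (a := top_form a).
  exists (hcomp b1 (fdeg a + fdeg f3) (fdeg f1)), (hcomp c1 (fdeg a + fdeg f3) (fdeg f2)).
  by rewrite -!cf_mul // -coefD -rmorphD -abc -top_formM -fdegM.
set h1 := hcomp e1 (fdeg a) (fdeg f1); set h2 := hcomp e2 (fdeg a) (fdeg f2).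
have {}ae : top_form a = h1 * g1 + h2 * g2.
  by rewrite -[LHS](cf_homog (top_form_homog a)) ae rmorphD coefD !cf_mul_top.
have [||b' [c' a'E]] := IHn (a - (h1 * f1 + h2 * f2)).
- apply: (@leq_trans (size (Phi a))) => //; rewrite (size_Phi a0) ltnS.
  apply: size_drop.
    apply: size_PhiB; first by rewrite size_Phi.
    by apply: size_PhiD; apply: size_hcomp_mul.
  by rewrite rmorphB coefB rmorphD coefD !cf_hcomp_mul -ae subrr.
- exists (b1 - h1 * f3), (c1 - h2 * f3); rewrite mulrBl abc; ring.
exists (b' + h1), (c' + h2); rewrite -[LHS](subrK (h1 * f1 + h2 * f2)) a'E; ring.
Qed.

End LeadingForms.

(** * Leading forms that are monomials *)

Lemma mpolyC_intr n (c : int) : c%:MP = c%:~R :> {mpoly int[n]}.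
Proof. by rewrite -[c in LHS]intz rmorph_int. Qed.

Section Substitution.
Variables (n : nat) (T : comNzRingType).
Local Notation S := {mpoly int[n]}.
Implicit Types (m : 'X_{1..n}) (p : S) (h : 'I_n -> T).

Definition subst h : S -> T := mmap intr h.
HB.instance Definition _ h := GRing.RMorphism.on (subst h).

Lemma substX h i : subst h 'X_i = h i.
Proof. by rewrite /subst mmapX mmap1U. Qed.

Lemma substXm h m : subst h 'X_[m] = \prod_i h i ^+ m i.
Proof. by rewrite /subst mmapX. Qed.

Lemma rmorph_mpoly_ext (F G : {rmorphism S -> T}) :
  (forall i, F 'X_i = G 'X_i) -> F =1 G.
Proof.
move=> FG p; rewrite (mpolyE p) !rmorph_sum; apply: eq_bigr => m _.
rewrite -mul_mpolyC !rmorphM mpolyXE_id !rmorph_prod.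
rewrite mpolyC_intr !rmorph_int; congr (_ * _).
by apply: eq_bigr => i _; rewrite !rmorphXn FG.
Qed.

End Substitution.

Section Restriction.
Variable n : nat.
Local Notation S := {mpoly int[n]}.
Implicit Types (m : 'X_{1..n}) (p : S) (K : pred 'I_n).

Definition supported K m := [forall i, (0 < m i)%N ==> K i].

Definition restrict K : S -> S := subst (fun i => if K i then 'X_i else 0).
HB.instance Definition _ K := GRing.RMorphism.on (restrict K).

Lemma restrictX K i : restrict K 'X_i = if K i then 'X_i else 0.
Proof. exact: substX. Qed.

Lemma restrictXm K m : restrict K 'X_[m] = if supported K m then 'X_[m] else 0.
Proof.
rewrite /restrict substXm; case: ifPn => [/forallP Km|].
  rewrite [RHS]mpolyXE_id; apply: eq_bigr => i _.
  by have := Km i; case: (m i) => [|k] //= ->.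
rewrite negb_forall => /existsP[i]; rewrite negb_imply => /andP[mi Ki].
by rewrite (bigD1 i) //= (negbTE Ki) expr0n eqn0Ngt mi mul0r.
Qed.

Lemma restrictE K p : restrict K p = \sum_(m <- msupp p | supported K m) p@_m *: 'X_[m].
Proof.
rewrite [in LHS](mpolyE p) rmorph_sum [RHS]big_mkcond; apply: eq_bigr => m _ /=.
rewrite -mul_mpolyC rmorphM /= restrictXm mpolyC_intr.
by rewrite rmorph_int; case: ifP => _; rewrite ?mulr0.
Qed.

Lemma mcoeff_restrict K p m : supported K m -> (restrict K p)@_m = p@_m.
Proof.
move=> Km; rewrite restrictE [in RHS](mpolyE p) !raddf_sum /= big_mkcond.
apply: eq_bigr => m' _; case: ifPn => // Km'; rewrite linearZ /= mcoeffX.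
by case: eqP Km' => [->|]; rewrite ?Km ?mulr0.
Qed.

(** Restriction to K does not change the coefficients of monomials in the
    variables of K. *)
Lemma restrict_eq0 K p m : restrict K p = 0 -> m \in msupp p -> ~~ supported K m.
Proof.
move=> p0 mp; apply/negP => Km; move: mp.
by rewrite mcoeff_msupp -(mcoeff_restrict p Km) p0 mcoeff0 eqxx.
Qed.

Lemma supported_predC1 v m : supported (predC1 v) m = (m v == 0)%N.
Proof.
apply/forallP/eqP=> [/(_ v)|mv i]; first by rewrite /= eqxx implybF -eqn0Ngt => /eqP.
by apply/implyP; apply: contraTneq => ->; rewrite mv.
Qed.

Definition monic_monomial (s : seq 'I_n) : S := \prod_(v <- s) 'X_v.

Lemma monic_monomialE s : monic_monomial s = 'X_[\sum_(v <- s) U_(v)].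
Proof.
rewrite /monic_monomial; elim: s => [|v s IHs]; first by rewrite !big_nil mpolyX0.
by rewrite !big_cons IHs mpolyXD.
Qed.

Lemma monic_monomial_dvd s m : uniq s -> {in s, forall v, (0 < m v)%N} ->
  exists q : S, 'X_[m] = q * monic_monomial s.
Proof.
move=> us ms; rewrite monic_monomialE.
set mu := (\sum_(v <- s) U_(v))%MM.
have le_mu : (mu <= m)%MM.
  apply/mnm_lepP => i; rewrite mnm_sumE.
  rewrite (eq_bigr (fun v => (v == i) : nat)); last by move=> v _; rewrite mnm1E.
  rewrite -big_mkcond sum1_count /= count_uniq_mem //.
  by case: (boolP (i \in s)) => // /ms.
by exists 'X_[m - mu]; rewrite -mpolyXD submK.
Qed.

Lemma restrict_monic_monomial K s :
  restrict K (monic_monomial s) = if all K s then monic_monomial s else 0.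
Proof.
rewrite /monic_monomial rmorph_prod /=; elim: s => [|v s IHs]; rewrite ?big_nil //=.
rewrite !big_cons IHs restrictX; case: (K v); rewrite ?mul0r //=.
by case: ifP => _; rewrite ?mulr0.
Qed.

Lemma monic_monomial_neq0 s : monic_monomial s != 0.
Proof. by rewrite monic_monomialE -msupp_eq0 msuppX. Qed.

Lemma monomial_ideal1 s p : uniq s ->
  {in s, forall v, restrict (predC1 v) p = 0} ->
  exists q, p = q * monic_monomial s.
Proof.
move=> us ps; rewrite (mpolyE p) big_seq.
elim/big_ind: _ => [|x y [q ->] [q' ->]|m mp]; first by exists 0; rewrite mul0r.
  by exists (q + q'); rewrite mulrDl.
have [|q ->] := @monic_monomial_dvd s m us.
  move=> v /ps p0; rewrite lt0n -supported_predC1; exact: restrict_eq0 mp.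
by exists (p@_m *: q); rewrite scalerAl.
Qed.

(** The ideal of two squarefree monomials is the intersection of the
    ideals generated by one variable of each: a monomial outside misses some
    variable v of the first and some variable w of the second. *)
Lemma monomial_ideal2 s t p : uniq s -> uniq t ->
  {in s & t, forall v w, restrict [pred i | (i != v) && (i != w)] p = 0} ->
  exists b c, p = b * monic_monomial s + c * monic_monomial t.
Proof.
move=> us ut pst; rewrite (mpolyE p) big_seq.
elim/big_ind: _ => [|x y [q [r ->]] [q' [r' ->]]|m mp].
- by exists 0, 0; rewrite !mul0r addr0.
- by exists (q + q'), (r + r'); rewrite !mulrDl addrACA.
have [/allP sm|/allPn[v vs mv]] := boolP (all (fun v => 0 < m v)%N s).
  have [q ->] := monic_monomial_dvd us sm.
  by exists (p@_m *: q), 0; rewrite scalerAl mul0r addr0.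
have [/allP tm|/allPn[w wt mw]] := boolP (all (fun v => 0 < m v)%N t).
  have [q ->] := monic_monomial_dvd ut tm.
  by exists 0, (p@_m *: q); rewrite scalerAl mul0r add0r.
have /negP[] := restrict_eq0 (pst v w vs wt) mp.
apply/forallP=> i; apply/implyP=> mi /=.
by apply/andP; split; apply: contraTneq mi => ->.
Qed.

End Restriction.

Section KeptDegree.
Variables (n : nat) (K : pred 'I_n).
Local Notation S := {mpoly int[n]}.
Implicit Types (m : 'X_{1..n}) (p x : S).

(** Multiplies each variable of K by a new variable, whose degree then counts
    the variables of K. *)
Definition mark : S -> {poly S} := subst (fun i => ('X_i)%:P * 'X^(K i)).
HB.instance Definition _ := GRing.RMorphism.on mark.

Definition kept_deg m : nat := (\sum_i K i * m i)%N.

Lemma markXm m : mark 'X_[m] = 'X_[m] *: 'X^(kept_deg m).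
Proof.
rewrite /mark substXm /kept_deg -mul_polyC mpolyXE_id rmorph_prod expr_sum.
rewrite -big_split; apply: eq_bigr => i _ /=.
by rewrite exprMn rmorphXn -exprM.
Qed.

Lemma markE p : mark p = \sum_(m <- msupp p) (p@_m *: 'X_[m]) *: 'X^(kept_deg m).
Proof.
rewrite [in LHS](mpolyE p) rmorph_sum; apply: eq_bigr => m _ /=.
rewrite -mul_mpolyC rmorphM /= markXm mpolyC_intr.
by rewrite rmorph_int -[RHS]scalerA scaler_int mulrzl.
Qed.

Lemma mark_homog x k : mark (mark x)`_k = (mark x)`_k *: 'X^k.
Proof.
rewrite (markE x) coef_sum rmorph_sum scaler_suml; apply: eq_bigr => m _.
rewrite coefZ coefXn; case: eqP => [->|_]; last by rewrite mulr0 rmorph0 scale0r.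
rewrite mulr1 -mul_mpolyC rmorphM /= markXm mpolyC_intr.
by rewrite rmorph_int -scalerA scaler_int mulrzl.
Qed.

Lemma mark_eval1 x : (mark x).[1] = x.
Proof.
rewrite markE horner_sum [RHS](mpolyE x); apply: eq_bigr => m _.
by rewrite hornerZ hornerXn expr1n mulr1.
Qed.

Lemma kept_deg_le m : (kept_deg m <= mdeg m)%N.
Proof. by rewrite /kept_deg mdegE; apply: leq_sum => i _; case: (K i); rewrite ?mul1n. Qed.

Lemma kept_deg_eq m : (kept_deg m == mdeg m) = supported K m.
Proof.
rewrite /kept_deg mdegE eq_sym.
have le i : true -> (K i * m i <= m i ?= iff ((0 < m i) ==> K i))%N.
  move=> _; split; first by case: (K i); rewrite ?mul1n.
  by case: (K i); rewrite ?mul1n ?eqxx ?implybT // mul0n implybF -eqn0Ngt eq_sym.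
by rewrite eq_sym (leqif_sum le).
Qed.

(** In a homogeneous polynomial the terms of greatest degree in the variables
    of K are those with no other variable. *)
Lemma top_form_restrict p D : {in msupp p, forall m, mdeg m = D} ->
  restrict K p != 0 -> top_form mark p = restrict K p.
Proof.
move=> pD nz.
have cD : (mark p)`_D = restrict K p.
  rewrite markE restrictE coef_sum [RHS]big_mkcond; apply: eq_big_seq => m mp /=.
  rewrite coefZ coefXn -kept_deg_eq pD // eq_sym.
  by case: eqP; rewrite ?mulr1 ?mulr0.
have sD : (size (mark p) <= D.+1)%N.
  rewrite markE big_seq; apply: (leq_trans (size_sum _ _ _)).
  apply/bigmax_leqP_seq => m mp _; apply: (leq_trans (size_scale_leq _ _)).
  by rewrite size_polyXn ltnS -(pD m mp) kept_deg_le.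
rewrite /top_form lead_coefE -cD; congr (_`__).
suff -> : size (mark p) = D.+1 by [].
apply/eqP; rewrite eqn_leq sD ltnNge; apply: contraNN nz => le_D.
by rewrite -cD nth_default.
Qed.

End KeptDegree.

Section MonomialLeadingForms.
Variables (n : nat) (K : pred 'I_n) (s t : seq 'I_n) (v0 w0 : 'I_n).
Local Notation S := {mpoly int[n]}.
Variables (f1 f2 f3 : S) (e : bool) (D1 D2 D3 : nat).
Hypotheses (us : uniq s) (ut : uniq t).
Hypothesis st : forall v, v \in s -> v \notin t.
Hypotheses (v0s : v0 \in s) (w0t : w0 \in t).
Hypothesis f1K : restrict K f1 = monic_monomial s.
Hypothesis f2K : restrict K f2 = (-1) ^+ e * monic_monomial t.
Hypothesis f3K : forall v w, v \in s -> w \in t ->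
  restrict [pred i | (i != v) && (i != w)] (restrict K f3) != 0.
Hypothesis f1_homog : {in msupp f1, forall u, mdeg u = D1}.
Hypothesis f2_homog : {in msupp f2, forall u, mdeg u = D2}.
Hypothesis f3_homog : {in msupp f3, forall u, mdeg u = D3}.

(** An element whose product with the leading form of f3 lies in the ideal of
    the two monomials vanishes on every
    coordinate subspace where one variable of each is zero, the restriction of
    f3 being a nonzero element of a domain there; so it lies in the
    intersection described in [monomial_ideal2]. *)
Lemma regular_of_restrict :
  (forall c, (exists b, c * f2 = b * f1) -> exists b, c = b * f1) /\
  (forall a, (exists b c, a * f3 = b * f1 + c * f2) ->
     exists b c, a = b * f1 + c * f2).
Proof.
have nz1 : restrict K f1 != 0 by rewrite f1K monic_monomial_neq0.
have nz2 : restrict K f2 != 0.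
  by rewrite f2K mulf_neq0 ?signr_eq0 ?monic_monomial_neq0.
have nz3 : restrict K f3 != 0.
  by apply: contraNneq (f3K v0s w0t) => ->; rewrite rmorph0.
have t1 := top_form_restrict f1_homog nz1.
have t2 := top_form_restrict f2_homog nz2.
have t3 := top_form_restrict f3_homog nz3.
have nz x : restrict K x != 0 -> x != 0 by apply: contraNneq => ->; rewrite rmorph0.
have reg2 c : (exists b, c * top_form (mark K) f2 = b * top_form (mark K) f1) ->
    exists b, c = b * top_form (mark K) f1.
  rewrite t1 t2 f1K f2K => -[b cb].
  apply: (monomial_ideal1 us) => v vs.
  have := congr1 (restrict (predC1 v)) cb.
  rewrite !rmorphM rmorph_sign /= !restrict_monic_monomial.
  rewrite ifT; last first.
    by apply/allP=> w wt /=; apply: contraTneq wt => ->; apply: st.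
  rewrite ifF; last by apply/negbTE/allPn; exists v; rewrite //= eqxx.
  rewrite [RHS]mulr0 => /eqP.
  by rewrite !mulf_eq0 signr_eq0 (negbTE (monic_monomial_neq0 _)) !orbF => /eqP.
have zero_comb (b c k : S) : b * 0 + c * (k * 0) = 0 by rewrite !mulr0 addr0.
have reg3 a : (exists b c, a * top_form (mark K) f3 =
      b * top_form (mark K) f1 + c * top_form (mark K) f2) ->
    exists b c, a = b * top_form (mark K) f1 + c * top_form (mark K) f2.
  rewrite t1 t2 t3 f1K f2K => -[b [c abc]].
  have [|b' [c' ->]] := @monomial_ideal2 _ s t a us ut.
    move=> v w vs wt; set K' := [pred i | _].
    have := congr1 (restrict K') abc.
    rewrite rmorphD !rmorphM rmorph_sign /= !restrict_monic_monomial.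
    rewrite ifF; last by apply/negbTE/allPn; exists v; rewrite //= eqxx.
    rewrite ifF; last by apply/negbTE/allPn; exists w; rewrite //= eqxx andbF.
    rewrite [RHS]zero_comb => /eqP.
    rewrite mulf_eq0 => /orP[/eqP a0|f30]; first exact: a0.
    by case/negP: (f3K vs wt); exact: f30.
  exists b', (c' * (-1) ^+ e); congr (_ + _).
  by rewrite -mulrA [X in _ = _ * X]mulrA -expr2 sqrr_sign mul1r.
split=> [c|a].
  exact: (regular2_of_top (mark_homog K) (mark_eval1 K) reg2).
exact: (regular3_of_top (mark_homog K) (mark_eval1 K) (nz _ nz1) (nz _ nz2)
         (nz _ nz3) reg2 reg3).
Qed.

End MonomialLeadingForms.

(** * Specializations of the generic matrix *)

Section Functoriality.
Variables (R T : comNzRingType) (F : {rmorphism R -> T}) (d : nat).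
Implicit Types (A : 'M[R]_d) (x : extalg R d) (v : 'rV[R]_d).

Definition map_ext x : extalg T d := [ffun S : {set 'I_d} => F (x S)].

Lemma map_ext_lmul i x : map_ext (lmul i x) = lmul i (map_ext x).
Proof.
by apply/ffunP=> S; rewrite !ffunE; case: ifP; rewrite ?rmorph0 // rmorphM rmorph_sign.
Qed.

Lemma map_ext_vmul v x : map_ext (vmul v x) = vmul (map_mx F v) (map_ext x).
Proof.
apply/ffunP=> S; rewrite ffunE /vmul !sum_ffunE rmorph_sum; apply: eq_bigr => i _.
by rewrite -map_ext_lmul !ffunE rmorphM mxE.
Qed.

Lemma map_ext_pfexp A : map_ext (pfexp A) = pfexp (map_mx F A).
Proof.
rewrite /pfexp; elim: (enum _) => [|k s IHs] /=.
  by apply/ffunP=> S; rewrite !ffunE; case: eqP => _; rewrite ?rmorph1 ?rmorph0.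
have mapD x y : map_ext (x + y) = map_ext x + map_ext y.
  by apply/ffunP=> S; rewrite !ffunE rmorphD.
rewrite mapD map_ext_lmul map_ext_vmul IHs; congr (_ + lmul _ (vmul _ _)).
by apply/rowP=> l; rewrite !mxE rmorphMn.
Qed.

(** Allows brackets of the generic matrix to be computed after specialization. *)
Lemma rmorph_bracket A (s : seq 'rV[R]_d) :
  F (bracket A s) = bracket (map_mx F A) (map (map_mx F) s).
Proof.
rewrite /bracket -map_ext_pfexp.
suff <- : map_ext (foldr (@vmul R d) (pfexp A) s)
  = foldr (@vmul T d) (map_ext (pfexp A)) (map (map_mx F) s) by rewrite ffunE.
by elim: s => //= v s IHs; rewrite map_ext_vmul IHs.
Qed.

End Functoriality.

Section SkewOf.
Variables (d : nat) (T : comNzRingType).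
Implicit Types (f : var d -> T) (i j : 'I_d).

Definition skew_of f : 'M[T]_d := \matrix_(i, j)
  if insub (i, j) is Some p then f (inl p)
  else if insub (j, i) is Some p then - f (inl p) else 0.

Definition vecs_of f : 'M[T]_(3, d) := \matrix_(k, i) f (inr (k, i)).

Lemma skew_of_ext f g : f =1 g -> skew_of f = skew_of g.
Proof.
move=> fg; apply/matrixP=> i j; rewrite !mxE; case: insub => [p|] //.
by case: insub => [p|] //; rewrite fg.
Qed.

Lemma vecs_of_ext f g : f =1 g -> vecs_of f = vecs_of g.
Proof. by move=> fg; apply/matrixP=> i j; rewrite !mxE fg. Qed.

Lemma skew_ofN f i j : skew_of f i j = - skew_of f j i.
Proof.
rewrite !mxE; case: insubP => [p /= lt_p _|]; case: insubP => [q /= lt_q _|] /=.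
- by move: (ltn_trans lt_p lt_q); rewrite ltnn.
- by rewrite opprK.
- by [].
by rewrite oppr0.
Qed.

Lemma skew_of_alternating f : alternating_mx (skew_of f).
Proof.
split=> i => [|j]; last exact: skew_ofN.
by rewrite mxE insubF //= ltnn.
Qed.

(** The variable c_(i,i+1).  The last index has no successor and gets another
    variable, which keeps the function injective. *)
Definition succ_var (i : 'I_d) : var d :=
  if insub (i, ordS i) is Some p then inl p else inr (ord0, i).

Lemma skew_of_succ f i : (i.+1 < d)%N -> skew_of f i (ordS i) = f (succ_var i).
Proof.
move=> lt_id; rewrite mxE /succ_var; case: insubP => // /negP[] /=.
by rewrite modn_small.
Qed.

Lemma succ_var_inj : injective succ_var.
Proof.
move=> i j; rewrite /succ_var; case: insubP => [p _ pE|_]; case: insubP => [q _ qE|_] //.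
  by move=> [eqpq]; move: pE qE; rewrite eqpq => -> [].
by case.
Qed.

Definition tridiagonal f : Prop :=
  forall p : {p : 'I_d * 'I_d | (p.1 < p.2)%N},
    (val p).2 != (val p).1.+1 :> nat -> f (inl p) = 0.

Lemma tridiagonalE f (i j : 'I_d) : tridiagonal f -> (i < j)%N -> j != i.+1 :> nat ->
  skew_of f i j = 0.
Proof.
move=> f3 lt_ij ji; rewrite mxE; case: insubP => [p _ pE|/negP[] //].
by apply: f3; rewrite pE.
Qed.

Variable f : var d -> T.
Hypothesis f_tri : tridiagonal f.
Local Notation E := (pfexp (skew_of f)).
Implicit Type P : {set 'I_d}.

Definition tail P (r : nat) : {set 'I_d} := [set t in P | (r <= t)%N].

Lemma tail0 P : tail P 0 = P.
Proof. by apply/setP=> t; rewrite !inE andbT. Qed.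

Lemma tail_skip P (i : 'I_d) : i \notin P -> tail P i = tail P i.+1.
Proof.
move=> iP; apply/setP=> t; rewrite !inE; case: (boolP (t \in P)) => //= tP.
rewrite leq_eqVlt; case: eqP => // eit.
by rewrite (val_inj eit) tP in iP.
Qed.

Lemma tail_end P : tail P d = set0.
Proof. by apply/setP=> t; rewrite !inE leqNgt ltn_ord andbF. Qed.

(** In a tridiagonal matrix the first element of the set can only be matched
    with its successor. *)
Lemma pfexp_tail2 P (i : 'I_d) : (i.+1 < d)%N -> i \in P -> ordS i \in P ->
  E (tail P i) = f (succ_var i) * E (tail P i.+2).
Proof.
move=> lt_id iP siP; set j := ordS i.
have jE : j = i.+1 :> nat by rewrite /= modn_small.
rewrite (@pfexp_min _ _ _ i) ?inE ?iP ?leqnn //; first last.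
- by move=> t; rewrite inE => /andP[].
- exact: skew_of_alternating.
have jT : j \in tail P i :\ i.
  by rewrite !inE -val_eqE [val j]jE siP jE leqnSn neq_ltn leqnn orbT.
rewrite (bigD1 j) //=.
rewrite big1 ?addr0 => [|l].
  rewrite skew_of_succ // (_ : nbelow j _ = 0%N); last first.
    apply/eqP; rewrite cards_eq0; apply/eqP/setP=> t; rewrite !inE jE.
    by rewrite ltnS -val_eqE /=; case: (ltngtP t i); rewrite ?andbF.
  rewrite expr0 mul1r; congr (_ * E _); apply/setP=> t; rewrite !inE -!val_eqE [val j]jE /=.
  by case: (t \in P); rewrite ?andbF //=; lia.
rewrite !inE -!val_eqE [val j]jE /= => /andP[/and3P[li lP le_il] lj].
by rewrite tridiagonalE ?mulr0 ?mul0r // ltn_neqAle eq_sym li.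
Qed.

(** Along a run of consecutive indices of even length the matching is
    forced. *)
Lemma pfexp_run P (s n : nat) : (s + n.*2 <= d)%N ->
    (forall t : 'I_d, (s <= t < s + n.*2)%N -> t \in P) ->
  E (tail P s) =
    (\prod_(i : 'I_d | (s <= i < s + n.*2)%N && (odd i == odd s)) f (succ_var i))
      * E (tail P (s + n.*2)).
Proof.
elim: n s => [|n IHn] s.
  by rewrite addn0 => _ _; rewrite big_pred0 ?mul1r // => i; case: ltngtP.
rewrite doubleS !addnS => le_d sP.
have lt_s : (s < d)%N by lia.
have lt_s1 : (s.+1 < d)%N by lia.
have sE : ordS (Ordinal lt_s) = s.+1 :> nat by rewrite /= modn_small.
rewrite (@pfexp_tail2 P (Ordinal lt_s)) //; first last.
- by apply: sP; rewrite sE; lia.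
- by apply: sP => /=; lia.
rewrite /= IHn; first last.
- by move=> t tP; apply: sP; lia.
- by lia.
rewrite [in RHS](bigD1 (Ordinal lt_s)) /=; last by rewrite eqxx andbT; lia.
rewrite !addSn mulrA; congr (_ * _ * _); apply: eq_bigl => i.
rewrite -val_eqE /= negbK.
have [->|is1] := eqVneq (i : nat) s.+1.
  by rewrite ltnn /=; case: (odd s); rewrite /= ?andbF.
rewrite [RHS]andbAC; congr (_ && _); lia.
Qed.

Lemma bracket_delta (i j : 'I_d) :
  exists e : bool, bracket (skew_of f) [:: delta_mx 0 i; delta_mx 0 j]
   = (-1) ^+ e * E (setT :\ i :\ j) *+ (i != j).
Proof.
rewrite /bracket /= !vmul_delta !ffunE !inE andbT eq_sym.
exists (odd (nbelow i setT + nbelow j (setT :\ i))); rewrite signr_odd exprD.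
by case: eqP; rewrite ?mulr0 // mulrA.
Qed.

End SkewOf.

Section MapSkewOf.
Variables (R T : comNzRingType) (F : {rmorphism R -> T}) (d : nat) (f : var d -> R).

Lemma map_skew_of : map_mx F (skew_of f) = skew_of (F \o f).
Proof.
apply/matrixP=> i j; rewrite !mxE; case: insub => [p|] //=; case: insub => [p|] /=.
  by rewrite rmorphN.
by rewrite rmorph0.
Qed.

Lemma map_row_vecs_of k : map_mx F (row k (vecs_of f)) = row k (vecs_of (F \o f)).
Proof. by apply/rowP=> i; rewrite !mxE. Qed.

End MapSkewOf.

(** * A regular sequence in the ideal *)

Lemma bracket2_sum (R : comNzRingType) d (A : 'M[R]_d) v w :
  bracket A [:: v; w] =
    \sum_i \sum_j v 0 i * w 0 j * bracket A [:: delta_mx 0 i; delta_mx 0 j].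
Proof.
rewrite (bracket_swap _ [::] [::]) (bracket_sum A [:: w]) -sumrN; apply: eq_bigr => i _.
rewrite (bracket_swap _ [::] [::]) (bracket_sum A [:: delta_mx 0 i]).
by rewrite mulrN opprK mulr_sumr; apply: eq_bigr => j _; rewrite mulrA.
Qed.

(** Used with a and b the first and last index, where the specialized u_1 is
    supported, while the specialized u_2 is supported at b. *)
Lemma bracket2_corner (R : comNzRingType) d (A : 'M[R]_d) (v w : 'rV[R]_d) a b :
    a != b -> (forall i, i != a -> i != b -> v 0 i = 0) ->
    (forall j, j != b -> w 0 j = 0) ->
  bracket A [:: v; w]
    = v 0 a * w 0 b * bracket A [:: delta_mx 0 a; delta_mx 0 b].
Proof.
move=> ab vz wz; rewrite bracket2_sum (bigD1 a) //= (bigD1 b) //=.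
rewrite [X in _ + X + _]big1 => [|j jb]; last by rewrite (wz j jb) mulr0 mul0r.
rewrite [X in _ + _ + X]big1 => [|i ia]; first by rewrite !addr0.
rewrite big1 // => j _; have [jb|/wz->] := eqVneq j b; last by rewrite mulr0 mul0r.
have [ib|/(vz _ ia)->] := eqVneq i b; last by rewrite !mul0r.
by rewrite ib jb (bracket_dup _ [::] [::]) mulr0.
Qed.

Lemma ord3_1 : 1 = inord 1 :> 'I_3.
Proof. by apply/eqP; rewrite -val_eqE /= inordK. Qed.

Section GenericRegularSequence.
Variables (d m : nat).
Hypotheses (dE : d = m.*2) (m_gt0 : (0 < m)%N).
Local Notation S := {mpoly int[nvar d]}.
Local Notation A := (generic_skew d).
Local Notation U := (vecs_of (@Xvar d)).

Fact first_lt : (0 < d)%N. Proof. by rewrite dE double_gt0. Qed.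
Fact last_lt : (d.-1 < d)%N. Proof. by rewrite prednK // first_lt. Qed.
Definition first_ord := Ordinal first_lt.
Definition last_ord := Ordinal last_lt.

Lemma substXvar (T : comNzRingType) (h : 'I_(nvar d) -> T) v :
  subst h (Xvar v) = h (enum_rank v).
Proof. exact: substX. Qed.

Lemma rmorph_generic_bracket (T : comNzRingType) (F : {rmorphism S -> T}) (k l : 'I_3) :
  F (bracket A [:: row k U; row l U]) =
  bracket (skew_of (F \o @Xvar d))
    [:: row k (vecs_of (F \o @Xvar d)); row l (vecs_of (F \o @Xvar d))].
Proof. by rewrite rmorph_bracket /= (map_skew_of F) !map_row_vecs_of. Qed.

Lemma rmorph_generic_pf (T : comNzRingType) (F : {rmorphism S -> T}) :
  F (bracket A [::]) = bracket (skew_of (F \o @Xvar d)) [::].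
Proof. by rewrite rmorph_bracket /= (map_skew_of F). Qed.

(** The variables that survive in the leading forms. *)
Definition kept (v : var d) : bool :=
  match v with
  | inl p => (val p).2 == (val p).1.+1 :> nat
  | inr (k, i) =>
    match val k with
    | 0 => (i == first_ord) || (i == last_ord)
    | 1 => i == last_ord
    | _ => true
    end
  end.

Definition keptK : pred 'I_(nvar d) := fun i => kept (enum_val i).

Definition kept_var (v : var d) : S := if kept v then Xvar v else 0.

Lemma restrict_Xvar : restrict keptK \o @Xvar d =1 kept_var.
Proof. by move=> v; rewrite /= /Xvar restrictX /keptK enum_rankK. Qed.

Lemma kept_tridiagonal : tridiagonal kept_var.
Proof. by move=> p np; rewrite /kept_var /= (negbTE np). Qed.

Lemma kept_succ (i : 'I_d) : (i.+1 < d)%N -> kept (succ_var i).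
Proof.
move=> lt_i; rewrite /succ_var; case: insubP => [p _ pE|/negP[]] /=.
  by rewrite pE /= modn_small.
by rewrite /= modn_small.
Qed.

Lemma kept_var_succ (i : 'I_d) : (i.+1 < d)%N ->
  kept_var (succ_var i) = 'X_(enum_rank (succ_var i)).
Proof. by move=> lt_i; rewrite /kept_var kept_succ. Qed.

(** The variables of the leading form of the Pfaffian: the matching of 0 with
    1, 2 with 3, and so on. *)
Definition even_vars : seq 'I_(nvar d) :=
  [seq enum_rank (succ_var i) | i <- [seq i : 'I_d <- enum 'I_d | ~~ odd i]].

(** The variables of the leading form of [u_1 u_2]: the first coordinate of
    u_1, the last one of u_2, and the matching of 1 with 2, 3 with 4, and so
    on. *)
Definition odd_vars : seq 'I_(nvar d) :=
  [:: enum_rank (inr (ord0, first_ord) : var d),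
      enum_rank (inr (inord 1, last_ord) : var d)
    & [seq enum_rank (succ_var i) | i <- [seq i : 'I_d <- enum 'I_d | odd i && (i != last_ord)]]].

Lemma rank_succ_inj : injective (fun i => enum_rank (@succ_var d i)).
Proof. by move=> i j /enum_rank_inj/succ_var_inj. Qed.

Lemma even_lt (i : 'I_d) : ~~ odd i -> (i.+1 < d)%N.
Proof. by have := ltn_ord i; lia. Qed.

Lemma odd_lt (i : 'I_d) : i != last_ord -> (i.+1 < d)%N.
Proof. by rewrite -val_eqE /=; have := ltn_ord i; lia. Qed.

Lemma even_vars_uniq : uniq even_vars.
Proof. by rewrite (map_inj_uniq rank_succ_inj) (filter_uniq _ (enum_uniq _)). Qed.

Lemma succ_var_inl (i : 'I_d) : (i.+1 < d)%N -> exists p, succ_var i = inl p.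
Proof.
move=> lt_i; rewrite /succ_var; case: insubP => [p _ _|/negP[]]; first by exists p.
by rewrite /= modn_small.
Qed.

Lemma odd_vars_uniq : uniq odd_vars.
Proof.
rewrite /odd_vars /= (map_inj_uniq rank_succ_inj) (filter_uniq _ (enum_uniq _)) andbT.
rewrite inE (inj_eq enum_rank_inj) /=; apply/andP; split.
  rewrite negb_or; apply/andP; split.
    by apply/eqP => -[] /(congr1 val); rewrite /= inordK.
  apply/mapP => -[i]; rewrite mem_filter => /andP[/andP[_ /odd_lt lt_i] _].
  by have [p ->] := succ_var_inl lt_i => /enum_rank_inj.
apply/mapP => -[i]; rewrite mem_filter => /andP[/andP[_ /odd_lt lt_i] _].
by have [p ->] := succ_var_inl lt_i => /enum_rank_inj.
Qed.

Lemma even_odd_disjoint v : v \in even_vars -> v \notin odd_vars.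
Proof.
case/mapP=> i; rewrite mem_filter => /andP[ei _] ->.
have [p pE] := succ_var_inl (even_lt ei).
rewrite !inE !(inj_eq enum_rank_inj) pE /= -pE; apply/mapP => -[j].
rewrite mem_filter => /andP[/andP[oj _] _] /enum_rank_inj/succ_var_inj ij.
by rewrite ij oj in ei.
Qed.

Lemma restrict_pf : restrict keptK (bracket A [::]) = monic_monomial even_vars.
Proof.
rewrite rmorph_generic_pf (skew_of_ext restrict_Xvar) /bracket /=.
have <- : tail [set: 'I_d] 0 = setT by apply/setP=> t; rewrite !inE.
rewrite (@pfexp_run _ _ _ kept_tridiagonal _ 0 m); first last.
- by move=> t _; rewrite inE.
- by rewrite dE.
rewrite add0n -dE tail_end pfexp0 mulr1 /monic_monomial big_map big_filter big_enum_cond.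
apply: eq_big => i; first by rewrite ltn_ord /= eqbF_neg.
by rewrite ltn_ord /= eqbF_neg => /even_lt/kept_var_succ.
Qed.

Lemma restrict_x01 : exists e : bool,
  restrict keptK (bracket A [:: row 0 U; row 1 U])
    = (-1) ^+ e * monic_monomial odd_vars.
Proof.
rewrite rmorph_generic_bracket (skew_of_ext restrict_Xvar) (vecs_of_ext restrict_Xvar).
have fl : first_ord != last_ord by rewrite -val_eqE /=; lia.
rewrite (bracket2_corner _ fl) => [|i iF iL|j jL]; first last.
- by rewrite !mxE /kept_var /= (negbTE jL).
- by rewrite !mxE /kept_var /= (negbTE iF) (negbTE iL).
rewrite ![row _ _ _ _]mxE ![vecs_of _ _ _]mxE /kept_var /= !eqxx /=.
have [e ->] := bracket_delta kept_var first_ord last_ord.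
exists e; rewrite fl mulr1n.
rewrite -(tail0 (setT :\ _ :\ _)) (@tail_skip _ _ first_ord) ?inE ?eqxx ?andbF //=.
rewrite (@pfexp_run _ _ _ kept_tridiagonal _ 1 m.-1); first last.
- by move=> t tP'; rewrite !inE -!val_eqE /=; lia.
- by lia.
have -> : (1 + m.-1.*2)%N = last_ord by rewrite /=; lia.
rewrite tail_skip ?inE ?eqxx //= prednK ?first_lt // tail_end pfexp0 mulr1.
rewrite /monic_monomial !big_cons big_map big_filter big_enum_cond /=.
rewrite [X in _ = _ * (_ * (_ * X))](_ : _ = \prod_(i : 'I_d | (0 < i < d.-1)%N
  && (odd i == true)) kept_var (succ_var i)).
  rewrite /Xvar; rewrite ord3_1.
  by rewrite mulrCA -mulrA.
apply: eq_big => i; last by case/andP=> _ /odd_lt lt_i; rewrite kept_var_succ.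
rewrite eqb_id -val_eqE /=; have := ltn_ord i; case: (boolP (odd i)) => oi; rewrite ?andbF //=; lia.
Qed.

(** At this point u_1 and u_3 are the unit vectors 0 and 2 i + 1, and the
    matrix is a perfect matching of the remaining indices: the odd links 1-2,
    3-4, ... below 2 i and the even ones above.  The entry (2 i, 2 i + 1) and the odd
    links above it vanish. *)
Definition point_even (i : nat) (v : var d) : int :=
  match v with
  | inl p => (((val p).2 == (val p).1.+1 :> nat) &&
     (if odd (val p).1 then (val p).1 < i.*2 else i.*2 < (val p).1)%N)%:R
  | inr (k, t) => ((k == 0) && (t == first_ord) || (k == ord_max) && (t == i.*2.+1 :> nat))%:R
  end.

(** The mirror image of [point_even]: u_1 and u_3 are the last unit vector and
    the one of index 2 i, even links below, odd links above. *)
Definition point_odd (i : nat) (v : var d) : int :=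
  match v with
  | inl p => (((val p).2 == (val p).1.+1 :> nat) &&
     (if odd (val p).1 then i.*2 < (val p).1 else (val p).1 < i.*2)%N)%:R
  | inr (k, t) => ((k == 0) && (t == last_ord) || (k == ord_max) && (t == i.*2 :> nat))%:R
  end.

Lemma bracket_rows_delta (T : comNzRingType) (f : var d -> T) (a b : 'I_d) :
    row 0 (vecs_of f) = delta_mx 0 a -> row ord_max (vecs_of f) = delta_mx 0 b ->
    a != b -> tridiagonal f -> pfexp (skew_of f) (setT :\ a :\ b) = 1 ->
  bracket (skew_of f) [:: row 0 (vecs_of f); row ord_max (vecs_of f)] != 0.
Proof.
move=> -> -> ab f3 E1; have [e ->] := bracket_delta f a b.
by rewrite ab E1 mulr1n mulr1 signr_eq0.
Qed.

Lemma point_even_neq0 (i : nat) : (i < m)%N ->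
  bracket (skew_of (point_even i))
    [:: row 0 (vecs_of (point_even i)); row ord_max (vecs_of (point_even i))] != 0.
Proof.
move=> lt_im; have lt_b : (i.*2.+1 < d)%N by rewrite dE; lia.
pose b := Ordinal lt_b.
have tri : tridiagonal (point_even i) by move=> p np; rewrite /= (negbTE np).
apply: (bracket_rows_delta (a := first_ord) (b := b)) => //.
- by apply/rowP=> t; rewrite !mxE /= orbF.
- by apply/rowP=> t; rewrite !mxE /= -val_eqE.
set P := _ :\ b; have run1 (t : 'I_d) : (t.+1 < d)%N ->
    point_even i (succ_var t) = (if odd t then t < i.*2 else i.*2 < t)%N%:R.
  move=> lt_t; rewrite /succ_var; case: insubP => [p _ pE|/negP[]] /=.
    by rewrite pE /= modn_small ?eqxx.
  by rewrite modn_small.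
rewrite -(tail0 P) (@tail_skip _ _ first_ord) ?inE ?eqxx ?andbF //=.
rewrite (@pfexp_run _ _ _ tri _ 1 i); first last.
- by move=> t tP; rewrite !inE -!val_eqE /=; lia.
- by lia.
rewrite (_ : (1 + i.*2)%N = b) // tail_skip ?inE ?eqxx //=.
rewrite (@pfexp_run _ _ _ tri _ i.*2.+2 (m - i.+1)); first last.
- by move=> t tP; rewrite !inE -!val_eqE /=; lia.
- by lia.
rewrite (_ : (i.*2.+2 + (m - i.+1).*2)%N = d); last by lia.
rewrite tail_end pfexp0 mulr1 !big1 ?mulr1 // => t.
  move=> /andP[/andP[le_t lt_t]] /= /eqP; rewrite negbK odd_double => ot.
  by rewrite run1; [rewrite ot (_ : (_ < _)%N) //; lia | lia].
move=> /andP[/andP[le_t lt_t]] /= /eqP ot.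
by rewrite run1; [rewrite ot (_ : (_ < _)%N) //; lia | lia].
Qed.

Lemma point_odd_neq0 (i : nat) : (i < m)%N ->
  bracket (skew_of (point_odd i))
    [:: row 0 (vecs_of (point_odd i)); row ord_max (vecs_of (point_odd i))] != 0.
Proof.
move=> lt_im; have lt_b : (i.*2 < d)%N by rewrite dE; lia.
pose b := Ordinal lt_b.
have tri : tridiagonal (point_odd i) by move=> p np; rewrite /= (negbTE np).
apply: (bracket_rows_delta (a := last_ord) (b := b)) => //.
- by apply/rowP=> t; rewrite !mxE /= orbF.
- by apply/rowP=> t; rewrite !mxE /= -val_eqE.
- by rewrite -val_eqE /=; lia.
set P := _ :\ b; have run1 (t : 'I_d) : (t.+1 < d)%N ->
    point_odd i (succ_var t) = (if odd t then i.*2 < t else t < i.*2)%N%:R.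
  move=> lt_t; rewrite /succ_var; case: insubP => [p _ pE|/negP[]] /=.
    by rewrite pE /= modn_small ?eqxx.
  by rewrite modn_small.
rewrite -(tail0 P) (@pfexp_run _ _ _ tri _ 0 i); first last.
- by move=> t tP; rewrite !inE -!val_eqE /=; lia.
- by lia.
rewrite (_ : (0 + i.*2)%N = b) // tail_skip ?inE ?eqxx //=.
rewrite (@pfexp_run _ _ _ tri _ i.*2.+1 (m - i.+1)); first last.
- by move=> t tP; rewrite !inE -!val_eqE /=; lia.
- by lia.
rewrite (_ : (i.*2.+1 + (m - i.+1).*2)%N = last_ord); last by rewrite /=; lia.
rewrite tail_skip ?inE ?eqxx ?andbF //= prednK ?first_lt // tail_end pfexp0 mulr1.
rewrite !big1 ?mulr1 // => t.
  move=> /andP[/andP[le_t lt_t]] /= /eqP; rewrite odd_double => ot.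
  by rewrite run1; [rewrite ot (_ : (_ < _)%N) //; lia | lia].
move=> /andP[lt_t]; rewrite eqbF_neg => /negbTE ot.
by rewrite run1; [rewrite ot (_ : (_ < _)%N) //; lia | lia].
Qed.

(** If v is the link of 2 i and 2 i + 1, both variables vanish at one of the two
    points of parameter i: [point_even] if w is the coordinate of u_2 or an odd
    link above v, [point_odd] if w is the coordinate of u_1 or an odd link
    below v. *)
Lemma restrict_x02_neq0 v w : v \in even_vars -> w \in odd_vars ->
  restrict [pred i | (i != v) && (i != w)]
    (restrict keptK (bracket A [:: row 0 U; row ord_max U])) != 0.
Proof.
move=> vE wO; set K' := [pred i | _].
suff [f [fK fv fw f_neq0]] : exists f : var d -> int,
    [/\ forall x, ~~ kept x -> f x = 0, f (enum_val v) = 0, f (enum_val w) = 0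
      & bracket (skew_of f) [:: row 0 (vecs_of f); row ord_max (vecs_of f)] != 0].
  pose F : {rmorphism S -> int} := subst (f \o enum_val).
  have Fext : F \o (restrict K' \o restrict keptK) =1 F.
    apply: (@rmorph_mpoly_ext _ _ (F \o (restrict K' \o restrict keptK)) F) => i /=.
    rewrite restrictX substX; case: ifP => [iK|/negbT/fK fi0]; last first.
      by rewrite /= fi0 !rmorph0.
    rewrite restrictX; case: ifPn => [_|]; first by rewrite substX.
    by rewrite negb_and !negbK rmorph0 => /orP[]/eqP-> /=; rewrite ?fv ?fw.
  apply: contraNneq f_neq0 => r0.
  have := Fext (bracket A [:: row 0 U; row ord_max U]).
  rewrite [(F \o _) _](congr1 F r0) rmorph0 rmorph_generic_bracket.
  have Ff : F \o @Xvar d =1 f by move=> x; rewrite /= substXvar /= enum_rankK.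
  by rewrite (skew_of_ext Ff) (vecs_of_ext Ff) => <-.
case/mapP: vE => i; rewrite mem_filter => /andP[ei _] ->.
have iE : (i : nat) = i./2.*2 by rewrite even_halfK.
have lt_im : (i./2 < m)%N by have := ltn_ord i; lia.
have succE (f : var d -> int) (t : 'I_d) : (t.+1 < d)%N ->
    exists2 p, succ_var t = inl p & val p = (t, ordS t).
  move=> lt_t; rewrite /succ_var; case: insubP => [p _ pE|/negP[]] /=; first by exists p.
  by rewrite modn_small.
have [p pE pv] := succE (fun=> 0) i (even_lt ei).
have even_kept x : ~~ kept x -> point_even i./2 x = 0.
  case: x => [q|[k t]] /=; first by move/negbTE->.
  by case: k => [[|[|[|]]]] //= lk; rewrite negb_or => /andP[/negbTE-> _].
have odd_kept x : ~~ kept x -> point_odd i./2 x = 0.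
  case: x => [q|[k t]] /=; first by move/negbTE->.
  by case: k => [[|[|[|]]]] //= lk; rewrite negb_or => /andP[_ /negbTE->].
have even_i : point_even i./2 (succ_var i) = 0.
  by rewrite pE /= pv /= (negbTE ei) -iE ltnn andbF.
have odd_i : point_odd i./2 (succ_var i) = 0.
  by rewrite pE /= pv /= (negbTE ei) -iE ltnn andbF.
move: wO; rewrite !inE => /or3P[/eqP->|/eqP->|/mapP[j]].
- exists (point_odd i./2); rewrite !enum_rankK; split=> //; last exact: point_odd_neq0.
  by rewrite /= -val_eqE /=; case: eqP => //; lia.
- exists (point_even i./2); rewrite !enum_rankK; split=> //; last exact: point_even_neq0.
  by rewrite /= -!val_eqE /= inordK.
rewrite mem_filter => /andP[/andP[oj /odd_lt lt_j] _] ->.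
have [q qE qv] := succE (fun=> 0) j lt_j.
have [lt_ji|le_ij] := ltnP j i.
  exists (point_odd i./2); rewrite !enum_rankK; split=> //; last exact: point_odd_neq0.
  by rewrite qE /= qv /= oj -iE ltnNge (ltnW lt_ji) andbF.
exists (point_even i./2); rewrite !enum_rankK; split=> //; last exact: point_even_neq0.
by rewrite qE /= qv /= oj -iE ltnNge le_ij andbF.
Qed.

Lemma generic_regular D1 D2 D3
    (p := bracket A [::]) (x01 := bracket A [:: row 0 U; row 1 U])
    (x02 := bracket A [:: row 0 U; row ord_max U]) :
    {in msupp p, forall u, mdeg u = D1} -> {in msupp x01, forall u, mdeg u = D2} ->
    {in msupp x02, forall u, mdeg u = D3} ->
  (forall c : S, (exists b, c * x01 = b * p) -> exists b, c = b * p) /\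
  (forall a : S, (exists b c, a * x02 = b * p + c * x01) ->
     exists b c, a = b * p + c * x01).
Proof.
move=> hp h1 h2; have [e x01E] := restrict_x01.
have v0 : enum_rank (succ_var first_ord) \in even_vars.
  by apply: map_f; rewrite mem_filter mem_enum.
exact: (regular_of_restrict (K := keptK) even_vars_uniq odd_vars_uniq even_odd_disjoint
  v0 (mem_head _ _) restrict_pf x01E restrict_x02_neq0 hp h1 h2).
Qed.

End GenericRegularSequence.

(** * Bidegrees *)

Section WeightHomogeneous.
Variables (n : nat) (W : zmodType) (wt : 'I_n -> W).
Local Notation S := {mpoly int[n]}.
Implicit Types (w : W) (p q : S) (u : 'X_{1..n}).

Lemma mwt0 : mwt wt 0%MM = 0.
Proof. by rewrite /mwt big1 // => i _; rewrite mnm0E mulr0n. Qed.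

Lemma mwtD u u' : mwt wt (u + u')%MM = mwt wt u + mwt wt u'.
Proof. by rewrite /mwt -big_split; apply: eq_bigr => i _; rewrite mnmDE mulrnDr. Qed.

Lemma mwt1 i : mwt wt U_(i)%MM = wt i.
Proof.
rewrite /mwt (bigD1 i) //= mnm1E eqxx mulr1n big1 ?addr0 // => j ji.
by rewrite mnm1E eq_sym (negbTE ji) mulr0n.
Qed.

Lemma whomog0 w : whomog wt w (0 : S).
Proof. by move=> u; rewrite msupp0. Qed.

Lemma whomog1 : whomog wt 0 (1 : S).
Proof. by move=> u; rewrite msupp1 inE => /eqP->; apply: mwt0. Qed.

Lemma whomogX i : whomog wt (wt i) ('X_i : S).
Proof. by move=> u; rewrite msuppX inE => /eqP->; apply: mwt1. Qed.

Lemma whomogN w p : whomog wt w p -> whomog wt w (- p).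
Proof. by move=> hp u; rewrite (perm_mem (msuppN p)); apply: hp. Qed.

Lemma whomog_coef0 w p : w != 0 -> whomog wt w p -> p@_0%MM = 0.
Proof.
move=> nz hp; apply/eqP; rewrite mcoeff_eq0; apply: contra_neqN nz => /hp <-.
exact: mwt0.
Qed.

End WeightHomogeneous.

Section ExteriorWeight.
Variable d : nat.
Local Notation S := {mpoly int[nvar d]}.
Local Notation A := (generic_skew d).
Local Notation U := (vecs_of (@Xvar d)).
Local Notation wt := (@bideg d).
Implicit Types (x : extalg S d) (r s : int).

(** Each variable c accounts for two of the factors g_i; r counts the remaining
    factors and s is the degree in the u. *)
Definition ext_weight r s x : Prop := forall (T : {set 'I_d}) u,
  u \in msupp (x T) -> (mwt wt u).1 *+ 2 + r = #|T|%:Z /\ (mwt wt u).2 = s.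

Lemma ext_weightD r s x y :
  ext_weight r s x -> ext_weight r s y -> ext_weight r s (x + y).
Proof.
move=> hx hy T u; rewrite ffunE => /msuppD_le; rewrite mem_cat.
by case/orP; [apply: hx | apply: hy].
Qed.

Lemma ext_weight_sum r s (I : finType) (F : I -> extalg S d) :
  (forall i, ext_weight r s (F i)) -> ext_weight r s (\sum_i F i).
Proof.
move=> hF; elim/big_ind: _ => // [T u|x y]; last exact: ext_weightD.
by rewrite ffunE msupp0.
Qed.

Lemma ext_weight_lmul r s i x :
  ext_weight r s x -> ext_weight (r + 1) s (lmul i x).
Proof.
move=> hx T u; rewrite ffunE; case: ifP => [iT|_]; last by rewrite msupp0.
rewrite -signr_odd => usupp; have {usupp} : u \in msupp (x (T :\ i)).
  case: (odd _) usupp; rewrite ?mul1r // expr1 mulN1r.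
  by rewrite (perm_mem (msuppN _)).
by move/hx => [xT ->]; rewrite addrA xT (cardsD1 i T) iT PoszD addrC.
Qed.

Lemma ext_weight_scale a b r s (f : S) x : whomog wt (a, b) f ->
  ext_weight r s x -> ext_weight (r - a *+ 2) (s + b) (f *: x).
Proof.
move=> hf hx T u; rewrite ffunE => /msuppM_le/allpairsP[[v w] /= [vf wx ->]].
have [<- <-] := hx _ _ wx; rewrite mwtD (hf _ vf) /=; split; last by rewrite addrC.
by rewrite mulrnDl; ring.
Qed.

Lemma ext_weight_vmul a b r s (v : 'rV[S]_d) x :
  (forall i, whomog wt (a, b) (v 0 i)) -> ext_weight r s x ->
  ext_weight (r + 1 - a *+ 2) (s + b) (vmul v x).
Proof.
move=> hv hx; apply: ext_weight_sum => i.
by apply: ext_weight_scale => //; apply: ext_weight_lmul.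
Qed.

Lemma whomog_Xvar v : whomog wt (if v is inl _ then (1, 0) else (0, 1)) (@Xvar d v).
Proof.
have := @whomogX _ _ wt (enum_rank v); rewrite /bideg enum_rankK.
by case: v.
Qed.

Lemma whomog_generic_skew i j : whomog wt (1, 0) (A i j).
Proof.
rewrite mxE; case: insub => [p|]; first exact: (@whomog_Xvar (inl p)).
case: insub => [p|]; last exact: whomog0.
by apply: whomogN; apply: (@whomog_Xvar (inl p)).
Qed.

Lemma whomog_generic_vec k i : whomog wt (0, 1) (U k i).
Proof. by rewrite mxE; apply: (@whomog_Xvar (inr (k, i))). Qed.

Lemma ext_weight_pfexp : ext_weight 0 0 (pfexp A).
Proof.
rewrite /pfexp; elim: (enum _) => [|k s IHs] /=.
  move=> T u; rewrite ffunE; case: eqP => [->|_]; last by rewrite msupp0.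
  by rewrite msupp1 inE => /eqP->; rewrite mwt0 cards0.
apply: ext_weightD => //.
have Arow : forall i, whomog wt (1, 0) (row_on A s k 0 i).
  move=> i; rewrite mxE mulrb; case: ifP => _; last exact: whomog0.
  exact: whomog_generic_skew.
have := @ext_weight_lmul _ _ k _ (ext_weight_vmul Arow IHs).
by rewrite (_ : 0 + 1 - 1 *+ 2 + 1 = 0 :> int) // addr0.
Qed.

Lemma ext_weight_vec r s k x : ext_weight r s x ->
  ext_weight (r + 1) (s + 1) (vmul (row k U) x).
Proof.
move=> hx; rewrite -[r + 1]subr0 -[0](mul0rn _ 2).
apply: ext_weight_vmul => // i; rewrite mxE; exact: whomog_generic_vec.
Qed.

Lemma ext_weight_delta r s i x : ext_weight r s x ->
  ext_weight (r + 1) s (vmul (delta_mx 0 i) x).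
Proof. by rewrite vmul_delta; apply: ext_weight_lmul. Qed.

Lemma ext_weight_top m a r s x : d = (2 * m)%N -> r = a *+ 2 -> ext_weight r s x ->
  whomog wt (m%:Z - a, s) (x setT).
Proof.
move=> dE rE hx u /hx[]; rewrite cardsT card_ord rE.
case: (mwt wt u) => w1 w2 /= E ->; congr pair; lia.
Qed.

Variable m : nat.
Hypothesis dE : d = (2 * m)%N.

Lemma whomog_pf : whomog wt (m%:Z, 0) (pf_top A).
Proof.
rewrite -[m%:Z]subr0; apply: ext_weight_top dE _ ext_weight_pfexp; by rewrite mul0rn.
Qed.

Lemma whomog_pairing k l : whomog wt (m%:Z - 1, 2) (pairing A U k l).
Proof.
have H := @ext_weight_vec _ _ k _ (@ext_weight_vec _ _ l _ ext_weight_pfexp).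
by rewrite mxE; apply: (@ext_weight_top m 1 _ _ _ dE _ H).
Qed.

Lemma whomog_wmat k i : whomog wt (m%:Z - 1, 1) (wmat A U k i).
Proof.
have H := @ext_weight_vec _ _ k _ (@ext_weight_delta _ _ i _ ext_weight_pfexp).
by rewrite !mxE; apply: (@ext_weight_top m 1 _ _ _ dE _ H).
Qed.

Lemma whomog_zrow i : whomog wt (m%:Z - 2, 3) (zrow A U 0 i).
Proof.
have H := @ext_weight_vec _ _ ord0 _ (@ext_weight_vec _ _ (nx ord0) _
  (@ext_weight_vec _ _ (nx (nx ord0)) _ (@ext_weight_delta _ _ i _ ext_weight_pfexp))).
by rewrite !mxE; apply: (@ext_weight_top m 2 _ _ _ dE _ H).
Qed.

(** Every variable has total degree one. *)
Lemma mdeg_of_whomog a b (p : S) (D : nat) : a + b = D%:Z ->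
  whomog wt (a, b) p -> {in msupp p, forall u, mdeg u = D}.
Proof.
move=> abD hp u /hp; rewrite /mwt => uE.
apply/eqP; rewrite -eqz_nat -abD mdegE.
have -> : a + b = (\sum_i wt i *+ u i).1 + (\sum_i wt i *+ u i).2 by rewrite uE.
apply/eqP; apply: (big_rec2 (fun (x : nat) (y : int * int) => x%:Z = y.1 + y.2)) => //.
move=> i x y _ xy; rewrite PoszD xy /=.
have wi : (wt i).1 + (wt i).2 = 1 by rewrite /bideg; case: (enum_val i).
have -> : (wt i *+ u i).1 = (wt i).1 *+ u i by elim: (u i) => // k IH; rewrite !mulrS /= IH.
have -> : (wt i *+ u i).2 = (wt i).2 *+ u i by elim: (u i) => // k IH; rewrite !mulrS /= IH.
by rewrite addrACA -mulrnDl wi natz.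
Qed.

End ExteriorWeight.

(** * The almost complete intersection *)

Lemma ideal_span1 (R : comNzRingType) (f x : R) :
  x \in ideal_span [:: f] <-> exists b, x = b * f.
Proof.
split=> [/ideal_spanP[a ->]|[b ->]]; last by apply/ideal_spanM/mem_ideal_span/mem_head.
by exists (a ord0); rewrite big_ord_recl big_ord0 addr0.
Qed.

Lemma ideal_span2 (R : comNzRingType) (f g x : R) :
  x \in ideal_span [:: f; g] <-> exists b c, x = b * f + c * g.
Proof.
split=> [/ideal_spanP[a ->]|[b [c ->]]].
  by exists (a ord0), (a (lift ord0 ord0)); rewrite !big_ord_recl big_ord0 addr0.
by apply: ideal_spanD; apply/ideal_spanM/mem_ideal_span; rewrite !inE eqxx ?orbT.
Qed.

Section Assembly.
Variable m : nat.
Hypothesis m_gt0 : (0 < m)%N.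
Local Notation d := (2 * m)%N.
Local Notation S := {mpoly int[nvar d]}.
Local Notation A := (generic_skew d).
Local Notation U := (vecs_of (@Xvar d)).
Local Notation wt := (@bideg d).
Local Notation p := (pf_top A).
Local Notation x k l := (pairing A U k l).
Local Notation o0 := (ord0 : 'I_3).
Local Notation o1 := (nx ord0).
Local Notation o2 := (nx (nx ord0)).

Lemma generic_skew_alternating : alternating_mx A.
Proof. exact: skew_of_alternating. Qed.

Lemma generic_vecE k : generic_vec d k = ext_vec (row k U).
Proof. by apply: eq_bigr => i _; rewrite !mxE. Qed.

Lemma inord3E : [/\ inord 0 = o0, inord 1 = o1 & inord 2 = o2].
Proof. by split; apply/eqP; rewrite -val_eqE /= inordK. Qed.

Lemma idealI_gensE : idealI_gens m = [:: p; x o0 o1; x o0 o2; x o1 o2].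
Proof.
have [i0 i1 i2] := inord3E.
(* The divided power of index m - 1 lives in degree d - 2. *)
have mE : d = (2 * m.-1.+1)%N by rewrite prednK.
have wedgeE k l : ext_top (wedge (wedge (generic_power d m.-1) (generic_vec d k))
    (generic_vec d l)) = x k l.
  by rewrite !generic_vecE (ext_top_divpow2 _ _ generic_skew_alternating mE) [RHS]mxE.
have gensE : idealI_gens m = [:: ext_top (generic_power d m);
    ext_top (wedge (wedge (generic_power d m.-1) (generic_vec d (inord 0)))
                   (generic_vec d (inord 1)));
    ext_top (wedge (wedge (generic_power d m.-1) (generic_vec d (inord 0)))
                   (generic_vec d (inord 2)));
    ext_top (wedge (wedge (generic_power d m.-1) (generic_vec d (inord 1)))
                   (generic_vec d (inord 2)))] := erefl.
have pfE : ext_top (generic_power d m) = p := ext_top_divpow generic_skew_alternating (erefl d).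
rewrite gensE i0 i1 i2.
exact (f_equal2 cons pfE (f_equal2 cons (wedgeE _ _) (f_equal2 cons (wedgeE _ _)
        (f_equal2 cons (wedgeE _ _) erefl)))).
Qed.

Lemma xvecE : [/\ x o0 o1 = xvec A U 0 o2, x o0 o2 = - xvec A U 0 o1
  & x o1 o2 = xvec A U 0 o0].
Proof. by split; rewrite [xvec _ _ _ _]mxE ?nx3 // pairingN. Qed.

(** The entries of the first map of the complex; they differ from the given
    generators by order and by the sign of [u_1 u_3]. *)
Definition xgens : seq S := p :: [seq xvec A U 0 k | k <- enum 'I_3].

Lemma gens_xgens : {subset idealI_gens m <= ideal_span xgens}.
Proof.
have [e01 e02 e12] := xvecE.
have xI k : xvec A U 0 k \in ideal_span xgens.
  by apply: mem_ideal_span; rewrite inE map_f ?orbT // mem_enum.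
move=> f; rewrite idealI_gensE !inE => /or4P[]/eqP->.
- exact/mem_ideal_span/mem_head.
- by rewrite e01.
- by rewrite e02 -mulN1r; apply: ideal_spanM.
- by rewrite e12.
Qed.

Lemma xvec_idealI k : xvec A U 0 k \in ideal_span (idealI_gens m).
Proof.
have [e01 e02 e12] := xvecE; rewrite idealI_gensE.
have [->|->|->] := nxP ord0 k.
- by rewrite -e12; apply: mem_ideal_span; rewrite !inE eqxx ?orbT.
- rewrite -[xvec _ _ _ _]opprK -e02 -mulN1r; apply/ideal_spanM/mem_ideal_span.
  by rewrite !inE eqxx ?orbT.
- by rewrite -e01; apply: mem_ideal_span; rewrite !inE eqxx ?orbT.
Qed.

Lemma gens_contract :
  {in idealI_gens m, forall f, contracts (diff3 A U) (diff2 A U) (diff1 A U) f}.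
Proof.
move=> f /gens_xgens; apply: contracts_span => g; rewrite inE => /predU1P[->|].
  exact: contracts_pf generic_skew_alternating U.
by case/mapP=> k _ ->; apply: contracts_xvec generic_skew_alternating U k.
Qed.

Lemma diff1_row (a : 'M[S]_1) (b : 'rV[S]_3) :
  (row_mx a b *m diff1 A U) 0 0 = a 0 0 * p + \sum_k b 0 k * xvec A U 0 k.
Proof.
rewrite mul_row_col mul_mx_scalar !mxE [p * _]mulrC; congr (_ + _).
by apply: eq_bigr => k _; rewrite [_^T _ _]mxE.
Qed.

Lemma idealI_image (f : S) : f \in ideal_span (idealI_gens m) <->
  exists y : 'rV[S]_(1 + 3), f = (y *m diff1 A U) 0 0.
Proof.
split=> [/(sub_ideal_span (J := ideal_span xgens) gens_xgens)|[y ->]]; last first.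
  rewrite -(hsubmxK y) diff1_row; apply: ideal_spanD.
    by apply/ideal_spanM/mem_ideal_span; rewrite idealI_gensE mem_head.
  by apply: ideal_span_sum => k _; apply/ideal_spanM/xvec_idealI.
have gens_im (g : S) : g \in xgens -> exists y : 'rV[S]_(1 + 3), g = (y *m diff1 A U) 0 0.
  rewrite inE => /predU1P[->|/mapP[k _ ->]].
    exists (row_mx 1%:M 0); rewrite diff1_row mxE mul1r big1 ?addr0 // => k _.
    by rewrite mxE mul0r.
  exists (row_mx 0 (delta_mx 0 k)); rewrite diff1_row [X in X * p]mxE mul0r add0r.
  rewrite (bigD1 k) //= [delta_mx _ _ _ _]mxE !eqxx mul1r big1 ?addr0 // => l /negbTE lk.
  by rewrite [delta_mx _ _ _ _]mxE lk andbF mul0r.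
case/ideal_spanP=> a ->.
have /choice[y yE] (i : 'I_(size xgens)) := gens_im _ (mem_nth 0 (ltn_ord i)).
exists (\sum_i a i *: y i); rewrite mulmx_suml summxE; apply: eq_bigr => i _.
by rewrite -scalemxAl mxE yE.
Qed.

Definition const_coef : {rmorphism S -> int} := mcoeff 0%MM.

Lemma weights_neq0 : [/\ ((m%:Z, 0) : int * int) != 0, ((m%:Z - 1, 2) : int * int) != 0,
  ((m%:Z - 1, 1) : int * int) != 0 & ((m%:Z - 2, 3) : int * int) != 0].
Proof. by split; apply/eqP => -[] //; move: m_gt0; lia. Qed.

Lemma coef0_pf : const_coef p = 0.
Proof.
have [w _ _ _] := weights_neq0; exact: whomog_coef0 w (whomog_pf (erefl d)).
Qed.

Lemma coef0_pairing k l : const_coef (x k l) = 0.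
Proof.
have [_ w _ _] := weights_neq0; exact: whomog_coef0 w (whomog_pairing (erefl d) (k:=k) (l:=l)).
Qed.

Lemma coef0_diff2 : map_mx const_coef (diff2 A U) = 0.
Proof.
have [_ _ w1 w2] := weights_neq0.
have zero a b (M : 'M[S]_(a, b)) : (forall i j, const_coef (M i j) = 0) ->
    map_mx const_coef M = 0 by move=> M0; apply/matrixP=> i j; rewrite mxE M0 mxE.
rewrite /diff2 map_block_mx !zero ?block_mx0 // => i j.
- by rewrite mxE rmorphN /= [_%:M _ _]mxE raddfMn /= [_@__]coef0_pf mul0rn oppr0.
- by rewrite 2!mxE; apply: coef0_pairing.
- rewrite mxE [_^T _ _]mxE rmorphN /= [X in - X](_ : _ = 0) ?oppr0 //.
  exact: whomog_coef0 w1 (whomog_wmat (erefl d) (k:=j) (i:=i)).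
rewrite mxE ord1; exact: whomog_coef0 w2 (whomog_zrow (erefl d) (i:=i)).
Qed.

Lemma coef0_diff3 : map_mx const_coef (diff3 A U) = 0.
Proof.
have zero a b (M : 'M[S]_(a, b)) : (forall i j, const_coef (M i j) = 0) ->
    map_mx const_coef M = 0 by move=> M0; apply/matrixP=> i j; rewrite mxE M0 mxE.
rewrite /diff3 map_row_mx !zero ?row_mx0 // => i j.
  rewrite mxE [_^T _ _]mxE rmorphN /= [X in - X](_ : _ = 0) ?oppr0 //.
  exact: (whomog_coef0 (w := (0, 1)) _ (@whomog_generic_vec d j i)).
exact: (whomog_coef0 (w := (1, 0)) _ (@whomog_generic_skew d i j)).
Qed.

Definition reg_seq : seq S := [:: p; x o0 o1; x o0 o2].

Lemma reg_seq_regular : regular_sequence reg_seq.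
Proof.
have dE : d = m.*2 by rewrite mul2n.
have pE : p = bracket A [::] by [].
have o1E : 1 = o1 by apply: val_inj.
have o2E : ord_max = o2 by apply: val_inj.
have xE k l : x k l = bracket A [:: row k U; row l U] by rewrite mxE.
have x1E := etrans (xE o0 o1)
  (congr1 (fun j => bracket A [:: row 0 U; row j U]) (esym o1E)).
have x2E := etrans (xE o0 o2)
  (congr1 (fun j => bracket A [:: row 0 U; row j U]) (esym o2E)).
have hp := mdeg_of_whomog (addr0 m%:Z) (whomog_pf (erefl d)).
have hx k l := mdeg_of_whomog (_ : m%:Z - 1 + 2 = m.+1%:Z) (whomog_pairing (erefl d) (k:=k) (l:=l)).
have [|||r2 r3] := generic_regular dE m_gt0 (D1 := m) (D2 := m.+1) (D3 := m.+1).
- exact: hp.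
- by rewrite -x1E; apply: hx; lia.
- by rewrite -x2E; apply: hx; lia.
rewrite -x1E -x2E -pE in r2 r3.
have p0 : p != 0.
  rewrite pE; apply/eqP => p0; have := restrict_pf dE m_gt0; rewrite p0 rmorph0 => /eqP.
  by rewrite eq_sym (negbTE (monic_monomial_neq0 _)).
split; last first.
  apply/negP => /ideal_spanP[a /(congr1 const_coef)] /eqP.
  rewrite rmorph1 rmorph_sum big1 ?oner_eq0 // => i _; rewrite rmorphM /=.
  have : reg_seq`_i \in reg_seq by apply: mem_nth.
  rewrite !inE => /or3P[]/eqP->; rewrite [X in _ * X](_ : _ = 0) ?mulr0 //.
  - exact: coef0_pf.
  - exact: coef0_pairing.
  - exact: coef0_pairing.
move=> [|[|[|//]]] _ a /=.
- move=> /ideal_span_nil/eqP; rewrite mulf_eq0 (negbTE p0) orbF => /eqP->.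
  exact: (@rpred0 _ (@span_of S S^o [::])).
- by move=> /ideal_span1/r2 b; apply/ideal_span1.
- by move=> /ideal_span2/r3 b; apply/ideal_span2.
Qed.

Lemma reg_seq_idealI : {subset reg_seq <= ideal_span (idealI_gens m)}.
Proof.
move=> f fs; apply: mem_ideal_span; move: fs; rewrite idealI_gensE !inE.
by case/or3P=> ->; rewrite ?orbT.
Qed.

Lemma idealI_aci : almost_complete_intersection (idealI m) 3.
Proof.
have d_gt0 : (0 < d)%N by rewrite muln_gt0.
have D21 := diff21 generic_skew_alternating U; have D32 := diff32 generic_skew_alternating U.
split; [split|].
- exact: (grade_of_contracts D21 D32 gens_contract reg_seq_regular (erefl 3)
    reg_seq_idealI coef0_diff3 d_gt0).
- exact: (pd_of_contracts idealI_image D21 D32 gens_contract reg_seq_regular (erefl 3)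
    reg_seq_idealI coef0_diff3 d_gt0).
- exact: (minimal_of_contracts idealI_image D21 D32 gens_contract reg_seq_regular (erefl 3)
    reg_seq_idealI coef0_diff2 (erefl 4)).
Qed.

(** The degrees are forced by the bidegrees (m, 0), (m - 1, 2), (m - 2, 3),
    (m - 1, 1), (1, 0) and (0, 1) of p, x, z, w, A and U.  For m = 1 the
    vector z is zero, so that the negative entry does no harm. *)
Definition res_weight (i : nat) : 'I_(res_dim (1 + 3) (d + 3) d i) -> int * int :=
  match i return 'I_(res_dim (1 + 3) (d + 3) d i) -> int * int with
  | 1 => fun k => if split k is inl _ then (m%:Z, 0) else (m%:Z - 1, 2)
  | 2 => fun k => if split k is inl _ then (m%:Z *+ 2 - 2, 3) else (m%:Z *+ 2 - 1, 2)
  | 3 => fun=> (m%:Z *+ 2 - 1, 3)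
  | _ => fun=> 0
  end.

Lemma idealI_type : has_type wt (idealI m) d.
Proof.
have D21 := diff21 generic_skew_alternating U; have D32 := diff32 generic_skew_alternating U.
have [eps epsE] := augmentation_exists (idealI m).
exists (res_dim (1 + 3) (d + 3) d), res_weight.
exists (res_diff (diff1 A U) (diff2 A U) (diff3 A U)), eps; split=> //; first split.
- exact: (resolution_of_contracts idealI_image D21 D32 gens_contract reg_seq_regular
    (erefl 3) reg_seq_idealI epsE).
- case=> [|[|[|i]]] k l /=; last by have := ltn_ord k.
  + rewrite subr0 mxE; case: split => j.
      rewrite mxE !ord1 mulr1n; exact: whomog_pf.
    by rewrite 2!mxE; apply: whomog_pairing.
  + rewrite mxE; case: split => i; rewrite mxE; case: split => j.
    * rewrite mxE !ord1 (_ : _ - _ = (m%:Z - 2, 3)); first exact: whomog_zrow.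
      by congr pair => //=; lia.
    * rewrite mxE [_^T _ _]mxE (_ : _ - _ = (m%:Z - 1, 1)); last by congr pair => //=; lia.
      exact/whomogN/whomog_wmat.
    * rewrite 2!mxE (_ : _ - _ = (m%:Z - 1, 2)); last by congr pair => //=; lia.
      exact: whomog_pairing.
    * rewrite mxE [_%:M _ _]mxE (_ : _ - _ = (m%:Z, 0)); last by congr pair => //=; lia.
      apply: whomogN; case: eqP => _; first exact: whomog_pf.
      exact: whomog0.
  + rewrite mxE; case: split => j.
      rewrite (_ : _ - _ = (1, 0)); last by congr pair => //=; lia.
      exact: whomog_generic_skew.
    rewrite mxE [_^T _ _]mxE (_ : _ - _ = (0, 1)); last by congr pair => //=; lia.
    exact/whomogN/whomog_generic_vec.
- by move=> k; exists 1; [apply: whomog1 | rewrite epsE !mxE !eqxx !ord1 eqxx].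
have c2 := coef0_diff2; have c3 := coef0_diff3.
case=> [|[|[|i]]] k l /=; last by have := ltn_ord k.
- rewrite mxE; case: split => j; first by rewrite mxE !ord1 mulr1n; apply: coef0_pf.
  by rewrite 2!mxE; apply: coef0_pairing.
- by move/matrixP/(_ k l): c2; rewrite !mxE.
- by move/matrixP/(_ k l): c3; rewrite !mxE.
Qed.

End Assembly.

Theorem proposition3p1 (m n : nat) (m_ge1 : (1 <= m)%N)
    (n_eq : n = (2 * m + 3)%N) :
  [/\ almost_complete_intersection (idealI m) 3,
      has_type (@bideg (2 * m)) (idealI m) (2 * m)
    & (2 * m = n - 3)%N].
Proof.
split; [exact: idealI_aci | exact: idealI_type | by rewrite n_eq addnK].
Qed.
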